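(* Let $K$ be a number field, $\gamma\in\overline{\mathbb{Q}}$, and let $f_{K,\gamma}(x)=b_nx^n+\dots+b_1x+b_0\in K[x]$ (with $b_n=1$) be the monic minimal polynomial of $\gamma$ over $K$. For a nonzero prime ideal $\mathfrak{p}$ of $\mathcal{O}_K$ the following are equivalent: (i) $v_{\mathfrak{p}}(b_i)>v_{\mathfrak{p}}(b_0)$ for every $i\in\{1,\dots,n\}$; (ii) there exists $\alpha\in\mathfrak{p}$ with $1/\alpha\in\mathcal{O}_K[\gamma]$; (iii) for every nonzero prime ideal $\mathfrak{q}$ of $\mathcal{O}_{K(\gamma)}$ with $\mathfrak{q}\cap\mathcal{O}_K=\mathfrak{p}$ we have $v_{\mathfrak{q}}(\gamma)<0$.
   Context: $\mathcal{O}_K$ is the ring of integers of $K$; $v_{\mathfrak{p}}$ is the $\mathfrak{p}$-adic valuation (with $v_{\mathfrak{p}}(0)=+\infty$). $\mathcal{O}_K[\gamma]$ is the subring of $\overline{\mathbb{Q}}$ generated by $\mathcal{O}_K$ and $\gamma$. *)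

(* Defs.v *)
From HB Require Import structures.
From mathcomp Require Import all_boot all_order all_algebra all_field.
From Stdlib Require ClassicalEpsilon.
Set Implicit Arguments. Unset Strict Implicit. Unset Printing Implicit Defensive.
Import GRing.Theory Num.Theory.
Local Open Scope ring_scope.

(* Ambient number field L (finite extension of Q); the number field K is a
   subfield of L, and gamma is taken in L (L plays the role of any number
   field inside Qbar containing K(gamma)). *)
Section Defs.
Variable L : fieldExtType rat.

Definition alg_int (x : L) : Prop :=
  exists p : {poly int}, p \is monic /\ root (map_poly (fun z : int => z%:~R) p) x.

Definition ring_of_integers (F : {vspace L}) : L -> Prop :=
  fun x => x \in F /\ alg_int x.

Definition nonzero_prime_ideal (O P : L -> Prop) : Prop :=
  (forall x, P x -> O x) /\ P 0 /\
  (forall x y, P x -> P y -> P (x + y)) /\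
  (forall a x, O a -> P x -> P (a * x)) /\
  ~ P 1 /\
  (forall x y, O x -> O y -> P (x * y) -> P x \/ P y) /\
  (exists x, P x /\ x <> 0).

Fixpoint ideal_pow (O P : L -> Prop) (k : nat) (x : L) : Prop :=
  match k with
  | 0%N => O x
  | k'.+1 => exists s : seq (L * L),
      (forall ab, ab \in s -> P ab.1 /\ ideal_pow O P k' ab.2) /\
      x = \sum_(ab <- s) ab.1 * ab.2
  end.

Definition val_integral (O P : L -> Prop) (a : L) (v : nat) : Prop :=
  ideal_pow O P v a /\ ~ ideal_pow O P v.+1 a.

Definition val_rel (O P : L -> Prop) (x : L) (v : int) : Prop :=
  exists (a d : L) (va vd : nat),
    O a /\ O d /\ a <> 0 /\ d <> 0 /\ x = a / d /\
    val_integral O P a va /\ val_integral O P d vd /\ v = va%:Z - vd%:Z.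

(* the P-adic valuation, with None standing for +infinity = v_P(0) *)
Definition pval (O P : L -> Prop) (x : L) : option int :=
  if x == 0 then None
  else Some (ClassicalEpsilon.epsilon (inhabits 0) (val_rel O P x)).

Definition adjoin_ring (O : L -> Prop) (g x : L) : Prop :=
  exists p : {poly L}, (forall i, O p`_i) /\ x = p.[g].

End Defs.

Definition vlt (a b : option int) : bool :=
  match a, b with
  | Some x, Some y => (x < y)%R
  | Some _, None => true
  | None, _ => false
  end.

(* Main.v *)
From HB Require Import structures.
From mathcomp Require Import all_boot all_order all_fingroup all_algebra all_field.
From mathcomp Require Import boolp.
From mathcomp Require Import ring lra zify.
(* [perm.v] also defines a [pval]: [Defs] has to be imported last. *)
Require Import Defs.
Set Implicit Arguments. Unset Strict Implicit. Unset Printing Implicit Defensive.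
Import Order.TTheory GRing.Theory Num.Theory.
Local Open Scope ring_scope.

(** Write [A] and [B] for the rings of integers of [K] and [K(g)]. The
localization [loc] of [A] at [P] is a valuation ring by the [u, 1/u] lemma,
because every element of [K] is a root of a primitive integer polynomial; it is
discrete because the integers have only finitely many residues modulo a
positive integer. This finiteness comes from Dirichlet approximation and the
integrality of norms: a multiple [t x] of an integer [x] with bounded [t] is at
norm distance less than 1 from a fixed lattice, hence in it.

(i) -> (ii): dividing the minimal equation by its constant term gives
[1 = c.[g]] with [c] over [P], hence also over every power of [P]. The class of
[P] is torsion (Hurwitz's argument, with the same approximation), which turns
this into an element [alpha] of [P] with [1 / alpha] in [A[g]].

(ii) -> (iii): if [g] were integral at [Q], so would be [1 / alpha].

(iii) -> (i): let [p] be a positive integer in [P]. If the ideal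
[B :&: p g B[g]] avoided [A \ P], it would lie in a prime [Q] above [P],
impossible as [g] has a pole at [Q]. So it contains some [s] in [A \ P]; then
[s / g] is integral and [(s / g) ^+ n = p u] with [u] in [B]. The integral
equation of [u] gives a multiple of the minimal polynomial of [g] that is a
nonzero constant modulo [P], and Gauss's lemma concludes. *)

(** * Algebraic integers of a number field *)

Section AlgebraicIntegers.
Variable L : fieldExtType rat.
Implicit Types (x y : L).

Lemma intr_fieldExt_eq0 (z : int) : ((z%:~R : L) == 0) = (z == 0).
Proof.
by rewrite -[_%:~R](scaler_int _ (1:L)) scaler_eq0 oner_eq0 orbF intr_eq0.
Qed.

Lemma natr_fieldExt_eq0 (n : nat) : ((n%:R : L) == 0) = (n == 0)%N.
Proof. exact: (intr_fieldExt_eq0 n). Qed.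

Lemma intr_fieldExt_inj : injective (intr : int -> L).
Proof.
move=> a b /eqP; rewrite -subr_eq0 -intrB intr_fieldExt_eq0 subr_eq0.
by move/eqP.
Qed.

Lemma alg_intE x : alg_int x = integralOver (intr : int -> L) x.
Proof.
apply: propext; split => [[p [mp rp]]|[p mp rp]]; by exists p.
Qed.

Lemma alg_int_int (z : int) : alg_int (z%:~R : L).
Proof. rewrite alg_intE; exact: (integral_id (intr : int -> L)). Qed.

Lemma alg_int_nat (n : nat) : alg_int (n%:R : L).
Proof. exact: (alg_int_int n). Qed.

Lemma alg_intD x y : alg_int x -> alg_int y -> alg_int (x + y).
Proof. rewrite !alg_intE; exact: integral_add. Qed.

Lemma alg_intN x : alg_int x -> alg_int (- x).
Proof. rewrite !alg_intE; exact: integral_opp. Qed.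

Lemma alg_intM x y : alg_int x -> alg_int y -> alg_int (x * y).
Proof. rewrite !alg_intE; exact: integral_mul. Qed.

Lemma alg_int_root_monic (p : {poly L}) x :
  p \is monic -> (forall i, alg_int p`_i) -> root p x -> alg_int x.
Proof.
move=> mp ip rp; rewrite alg_intE; apply: (integral_root_monic mp rp).
by apply/integral_poly => i; rewrite -alg_intE.
Qed.

Lemma alg_int_dep (n : nat) (a : nat -> L) y :
  (forall i, alg_int (a i)) -> y ^+ n = \sum_(i < n) a i * y ^+ i -> alg_int y.
Proof.
move=> ia yE.
have sz : (size (- \poly_(i < n) a i) < size ('X^n : {poly L}))%N.
  by rewrite size_polyN size_polyXn ltnS size_poly.
apply: (@alg_int_root_monic ('X^n - \poly_(i < n) a i)).
- by rewrite monicE lead_coefDl // lead_coefXn.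
- move=> i; rewrite coefB coefXn coef_poly.
  apply: alg_intD; first exact: alg_int_nat.
  by apply: alg_intN; case: ifP => // _; exact: (alg_int_nat 0).
- by rewrite /root hornerD hornerN hornerXn horner_poly yE subrr.
Qed.

(* Multiply the relation by [c d ^+ d.-1]: it becomes monic in [c d * x]. *)
Lemma alg_int_lead (d : nat) (c : nat -> L) x :
  (forall i, alg_int (c i)) -> \sum_(i < d.+1) c i * x ^+ i = 0 ->
  alg_int (c d * x).
Proof.
case: d => [|d] ic.
  rewrite big_ord_recr big_ord0 /= add0r expr0 mulr1 => ->.
  rewrite mul0r; exact: (alg_int_nat 0).
rewrite big_ord_recr /= => /eqP; rewrite addrC addr_eq0 => /eqP rel.
have icX k : alg_int (c d.+1 ^+ k).
  by elim: k => [|k IH]; [exact: (alg_int_nat 1) | rewrite exprS; apply: alg_intM].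
apply: (@alg_int_dep d.+1 (fun i => - c i * c d.+1 ^+ (d - i))).
  by move=> i; apply: alg_intM => //; apply: alg_intN.
rewrite exprMn [in LHS]exprSr -mulrA rel mulrN mulr_sumr -sumrN.
apply: eq_bigr => i _.
have -> : c d.+1 ^+ d = c d.+1 ^+ (d - i) * c d.+1 ^+ i.
  by rewrite -exprD subnK // -ltnS.
by rewrite exprMn; ring.
Qed.

(** Scale the minimal polynomial over the rationals and divide by its content. Content 1 is what
    later yields a coefficient outside a given prime ideal. *)
Lemma primitive_relation x :
  exists q : {poly int}, zcontents q = 1 /\ root (map_poly intr q) x.
Proof.
have /polyOver1P [p pE] := minPolyOver 1%AS x.
have [q [a a0 pq]] := rat_poly_scale p.
have p0 : p != 0.
  apply/eqP => p0; have := monic_neq0 (monic_minPoly 1%AS x).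
  by rewrite pE p0 rmorph0 eqxx.
have q0 : q != 0.
  by apply/eqP => q0; move: p0; rewrite pq q0 rmorph0 scaler0 eqxx.
exists (zprimitive q); split; first by rewrite zcontents_primitive q0.
have : root (map_poly (intr : int -> L) q) x.
  have := root_minPoly 1%AS x; rewrite pE pq linearZ /=.
  rewrite rootZ ?scaler_eq0 ?invr_eq0 ?intr_eq0 ?(negPf a0) ?oner_eq0 //.
  congr (is_true (root _ _)); rewrite -map_poly_comp; apply: eq_map_poly => z /=.
  by rewrite -[LHS]/((z%:~R : rat)%:A) scaler_int.
have Eq : map_poly (intr : int -> L) q
    = (zcontents q)%:~R *: map_poly (intr : int -> L) (zprimitive q).
  by rewrite [in LHS](zpolyEprim q) linearZ.
rewrite Eq rootZ; last by rewrite intr_fieldExt_eq0 zcontents_eq0.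
by [].
Qed.

Lemma alg_int_denominator x : exists2 m : nat, (0 < m)%N & alg_int (m%:R * x).
Proof.
have [q [q1 rq]] := primitive_relation x.
have q0 : q != 0 by apply/eqP => q0; move: q1; rewrite q0 zcontents0.
have lq : lead_coef q != 0 by rewrite lead_coef_eq0.
have H : alg_int ((lead_coef q)%:~R * x).
  apply: (@alg_int_lead (size q).-1 (fun i => (q`_i)%:~R)).
    by move=> i; exact: alg_int_int.
  move: rq; rewrite /root horner_coef => /eqP.
  have -> : size (map_poly (intr : int -> L) q) = size q.
    by apply: size_map_inj_poly => //; exact: intr_fieldExt_inj.
  rewrite prednK ?size_poly_gt0 // => rq; rewrite -[RHS]rq.
  by apply: eq_bigr => i _; rewrite coef_map.
exists `|lead_coef q|%N; first by rewrite absz_gt0.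
have [z0|z0] := leP 0 (lead_coef q).
  have -> : `|lead_coef q|%N%:R = (lead_coef q)%:~R :> L by rewrite -[in RHS](gez0_abs z0).
  exact: H.
have -> : `|lead_coef q|%N%:R = - (lead_coef q)%:~R :> L.
  by rewrite -[in RHS](opprK (lead_coef q)) -(ltz0_abs z0) mulrNz opprK.
by rewrite mulNr; apply: alg_intN.
Qed.

End AlgebraicIntegers.

Lemma pigeonhole_nat {T : finType} (f : nat -> T) :
  exists i j, [/\ (i < j)%N, (j <= #|T|)%N & f i = f j].
Proof.
case: (boolP (injectiveb (fun i : 'I_#|T|.+1 => f i))) => [/injectiveP inj|].
  by have := leq_card _ inj; rewrite card_ord ltnn.
case/injectivePn => i [j ne_ij fij].
wlog lt_ij : i j ne_ij fij / (i < j)%N => [H|].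
  have [|lt_ji|/val_inj eq_ij] := ltngtP i j; first exact: H.
    by apply: (H j i) => //; rewrite eq_sym.
  by rewrite eq_ij eqxx in ne_ij.
by exists i, j; split => //; rewrite -ltnS.
Qed.

(** * The norm: integrality and size *)

Section Norm.
Import VectorInternalTheory.
Variable L : fieldExtType rat.
Implicit Types (x y : L).

Definition mul_mx x : 'M[rat]_(dim L) :=
  \matrix_i v2r (r2v (delta_mx 0 i) * x).

Lemma mul_mxE (u : 'rV_(dim L)) x : u *m mul_mx x = v2r (r2v u * x).
Proof.
rewrite [u in RHS]row_sum_delta mulmx_sum_row !linear_sum mulr_suml linear_sum.
apply: eq_bigr => i _.
by rewrite rowK !linearZ /= -scalerAl linearZ.
Qed.

Lemma mul_mxM x y : mul_mx (x * y) = mul_mx x *m mul_mx y.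
Proof.
apply/row_matrixP => i; rewrite row_mul !rowK mul_mxE v2rK; congr v2r.
by rewrite mulrA.
Qed.

Lemma mul_mx1 : mul_mx 1 = 1%:M.
Proof. by apply/row_matrixP => i; rewrite rowK mulr1 r2vK row1. Qed.

Lemma mul_mx_lin (n : nat) (r : 'I_n -> rat) (e : 'I_n -> L) :
  mul_mx (\sum_i r i *: e i) = \sum_i r i *: mul_mx (e i).
Proof.
apply/matrixP => j k; rewrite mxE summxE mulr_sumr linear_sum summxE.
by apply: eq_bigr => i _; rewrite !mxE -scalerAr linearZ mxE.
Qed.

(** The norm of [L] over the rationals, also for elements of a subfield: a single norm serves both
    [K] and [K(g)]. *)
Definition normL x : rat := \det (mul_mx x).

Lemma normLM x y : normL (x * y) = normL x * normL y.
Proof. by rewrite /normL mul_mxM det_mulmx. Qed.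

Lemma normL_neq0 x : x != 0 -> normL x != 0.
Proof.
move=> x0; apply/eqP => N0; have := normLM x x^-1.
rewrite divff // N0 mul0r /normL mul_mx1 det1 => /eqP.
by rewrite oner_eq0.
Qed.

(** An eigenvector for [a] is one for all powers of the matrix, so applying the monic integer
    equation of [x] to it gives the same equation for [a]. *)
Lemma alg_int_eigenvalue x (a : algC) :
  alg_int x -> eigenvalue (map_mx ratr (mul_mx x)) a -> a \in Aint.
Proof.
case=> p [mp rp] /eigenvalueP [v va v0].
suff ra : root (map_poly intr p) a.
  apply: (root_monic_Aint ra); first by rewrite monic_map.
  by apply/polyOverP => i; rewrite coef_map /= intr_int.
have vX k : v *m map_mx ratr (mul_mx (x ^+ k)) = a ^+ k *: v.
  elim: k => [|k IH].
    by rewrite expr0 mul_mx1 map_mx1 mulmx1 expr0 scale1r.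
  by rewrite exprSr mul_mxM map_mxM mulmxA IH -scalemxAl va scalerA exprSr.
have s0 : \sum_(i < size p) (p`_i)%:~R *: x ^+ i = 0 :> L.
  move: rp; rewrite /root horner_coef => /eqP rp; rewrite -[RHS]rp.
  have -> : size (map_poly (fun z : int => z%:~R : L) p) = size p.
    by apply: size_map_inj_poly => //; exact: intr_fieldExt_inj.
  apply: eq_bigr => i _; rewrite coef_map /= -[in RHS](scaler_int _ (1 : L)).
  by rewrite mulr_algl.
have := congr1 (fun z => v *m map_mx ratr (mul_mx z)) s0.
rewrite mul_mx_lin /=.
have -> : map_mx ratr (mul_mx 0) = 0 :> 'M[algC]_(dim L).
  by apply/matrixP => i j; rewrite !mxE mulr0 linear0 mxE rmorph0.
rewrite mulmx0 (raddf_sum (map_mx ratr)) mulmx_sumr /= => E.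
have {E} : (map_poly intr p).[a] *: v = 0.
  rewrite -[RHS]E horner_coef scaler_suml.
  have -> : size (map_poly (intr : int -> algC) p) = size p.
    by apply: size_map_inj_poly => //; exact: intr_inj.
  apply: eq_bigr => i _.
  by rewrite map_mxZ -scalemxAr vX scalerA coef_map /= ratr_int.
by move/eqP; rewrite scaler_eq0 (negPf v0) orbF.
Qed.

(** Up to sign the norm is the constant coefficient of the characteristic polynomial, a product of
    eigenvalues, hence an algebraic integer; a rational one is an integer. *)
Lemma normL_int x : alg_int x -> exists z : int, normL x = z%:~R.
Proof.
move=> ix.
have NA : (ratr (normL x) : algC) \in Aint.
  rewrite -det_map_mx.
  pose A : 'M[algC]_(dim L) := map_mx ratr (mul_mx x); rewrite -/A.
  have [r rE] := closed_field_poly_normal (char_poly A).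
  have rA (z : algC) : z \in r -> z \in Aint.
    move=> zr; apply: (alg_int_eigenvalue ix); rewrite eigenvalue_root_char.
    rewrite rE (eqP (char_poly_monic A)) scale1r.
    by rewrite root_prod_XsubC.
  have : (char_poly A)`_0 \in Aint.
    rewrite rE (eqP (char_poly_monic A)) scale1r -horner_coef0 horner_prod.
    rewrite big_seq; apply: rpred_prod => z zr.
    by rewrite hornerXsubC sub0r rpredN rA.
  by rewrite char_poly_det rpredMsign.
have : (ratr (normL x) : algC) \is a Num.int.
  by apply: Cint_rat_Aint NA; rewrite Crat_rat.
move/intrP => [z zE]; exists z; apply: (fmorph_inj (ratr : rat -> algC)).
by rewrite [RHS]ratr_int; exact: zE.
Qed.

Lemma normL_lt1 x : alg_int x -> `|normL x| < 1 -> x = 0.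
Proof.
move=> ix; have [z zE] := normL_int ix.
rewrite zE -intr_norm ltrz1 => lt1.
have z0 : z = 0 by move: lt1; lia.
apply/eqP; apply: contraT => /normL_neq0.
by rewrite zE z0 eqxx.
Qed.

Lemma det_bound (n : nat) (A : 'M[rat]_n) (c : rat) :
  (0 < n)%N -> c <= 1 -> (forall i j, `|A i j| <= c) ->
  `|\det A| <= (n`!)%:R * c.
Proof.
case: n A => // n A _ c1 Ac.
have c0 : 0 <= c by exact: le_trans (Ac 0 0).
rewrite /determinant; apply: (le_trans (ler_norm_sum _ _ _)).
apply: (@le_trans _ _ (\sum_(s : {perm 'I_n.+1}) c)); last first.
  by rewrite sumr_const card_Sn -[leLHS]mulr_natl.
apply: ler_sum => s _; rewrite normrMsign normr_prod.
apply: (@le_trans _ _ (\prod_(i < n.+1) c)).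
  by apply: ler_prod => i _; rewrite normr_ge0 Ac.
rewrite prodr_const card_ord exprS.
by rewrite ler_piMr // exprn_ile1.
Qed.

Lemma normL_small (n : nat) (e : 'I_n -> L) :
  exists m : nat, forall r : 'I_n -> rat,
    (forall i, `|r i| < m.+1%:R^-1) -> `|normL (\sum_i r i *: e i)| < 1.
Proof.
(* Coefficients below [1 / m.+1] keep all matrix entries at most [B / m.+1]; [m] is chosen so that
   the determinant bound [f * (B / m.+1)] is less than 1. *)
pose B := \sum_i \sum_j \sum_k `|mul_mx (e i) j k|.
pose f := ((dim L)`!)%:R : rat.
have f1 : 1 <= f by rewrite ler1n fact_gt0.
have B0 : 0 <= B by by apply: sumr_ge0 => ? _; apply: sumr_ge0 => ? _; apply: sumr_ge0.
pose m := Num.truncn (f * B); exists m => r rb.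
have mb : f * B < m.+1%:R by apply: truncnS_gt.
have m0 : 0 < m.+1%:R :> rat by rewrite ltr0n.
have dL : (0 < dim L)%N by rewrite -dimvf adim_gt0.
have cb : B / m.+1%:R <= 1.
  rewrite ler_pdivrMr // mul1r; apply: le_trans (ltW mb).
  by rewrite ler_peMl.
apply: (@le_lt_trans _ _ (f * (B / m.+1%:R))); last first.
  by rewrite mulrA ltr_pdivrMr // mul1r.
apply: det_bound => // j k; rewrite mul_mx_lin summxE.
apply: (le_trans (ler_norm_sum _ _ _)).
rewrite /B mulr_suml; apply: ler_sum => i _.
rewrite mxE normrM mulrC ler_pM // ?(ltW (rb i)) //.
rewrite (bigD1 j) //= (bigD1 k) //= -addrA lerDl.
by rewrite addr_ge0 // ?sumr_ge0 // => ? _; rewrite ?sumr_ge0.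
Qed.

End Norm.

(** * Rings of integers: approximation, finite residues, ideals *)

Section RingOfIntegers.
Variables (L : fieldExtType rat) (F : {subfield L}).
Local Notation O := (ring_of_integers F).
Implicit Types (x y z : L) (I J : L -> Prop).

Lemma roi_int (z : int) : O z%:~R.
Proof. by split; [exact: rpred_int | exact: alg_int_int]. Qed.

Lemma roi_nat (n : nat) : O n%:R. Proof. exact: (roi_int n). Qed.
Lemma roi0 : O 0. Proof. exact: (roi_nat 0). Qed.
Lemma roi1 : O 1. Proof. exact: (roi_nat 1). Qed.

Lemma roiD x y : O x -> O y -> O (x + y).
Proof. by move=> [xF ix] [yF iy]; split; [exact: rpredD | exact: alg_intD]. Qed.

Lemma roiN x : O x -> O (- x).
Proof. by move=> [xF ix]; split; [rewrite rpredN | exact: alg_intN]. Qed.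

Lemma roiB x y : O x -> O y -> O (x - y).
Proof. by move=> Ox Oy; apply: roiD => //; exact: roiN. Qed.

Lemma roiM x y : O x -> O y -> O (x * y).
Proof. by move=> [xF ix] [yF iy]; split; [exact: rpredM | exact: alg_intM]. Qed.

Lemma roiX x (n : nat) : O x -> O (x ^+ n).
Proof. by move=> Ox; elim: n => [|n IH]; [exact: roi1 | rewrite exprS; exact: roiM]. Qed.

Lemma roi_sum (T : Type) (s : seq T) (Q : pred T) (f : T -> L) :
  (forall i, Q i -> O (f i)) -> O (\sum_(i <- s | Q i) f i).
Proof. by move=> Of; apply: big_ind => //; [exact: roi0 | exact: roiD]. Qed.

Lemma roi_denominator x : x \in F -> exists2 m : nat, (0 < m)%N & O (m%:R * x).
Proof.
move=> xF; have [m m0 im] := alg_int_denominator x.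
by exists m => //; split => //; apply: rpredM => //; exact: rpred_nat.
Qed.

Record is_ideal I : Prop := IsIdeal {
  ideal_sub : forall x, I x -> O x;
  ideal0 : I 0;
  idealD : forall x y, I x -> I y -> I (x + y);
  idealM : forall a x, O a -> I x -> I (a * x) }.

Lemma idealB I x y : is_ideal I -> I x -> I y -> I (x - y).
Proof.
move=> iI Ix Iy; apply: (idealD iI) => //; rewrite -mulN1r.
by apply: (idealM iI) => //; apply: roiN; exact: roi1.
Qed.

Lemma ideal_sum I (T : Type) (s : seq T) (Q : pred T) (f : T -> L) :
  is_ideal I -> (forall i, Q i -> I (f i)) -> I (\sum_(i <- s | Q i) f i).
Proof. by move=> iI If; apply: big_ind => //; [exact: ideal0 | exact: idealD]. Qed.

(** A vector space basis of [F] times denominators: it spans [F] over the rationals, but possibly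
    not [O] over the integers. *)
Lemma integral_basis_approx :
  exists d (w : 'I_d -> L), (forall i, O (w i)) /\
    forall x, x \in F -> exists q : 'I_d -> rat, x = \sum_i q i *: w i.
Proof.
pose b := vbasis F.
have bF i : b`_i \in F.
  have [lt|ge] := ltnP i (size b); last by rewrite nth_default // rpred0.
  by apply: vbasis_mem; rewrite mem_nth.
have H i : exists m : nat, (0 < m)%N /\ O (m%:R * b`_i).
  by have [m m0 Om] := roi_denominator (bF i); exists m.
have [m mP] := boolp.choice H.
exists (\dim F), (fun i => (m i)%:R * b`_i); split=> [i|x xF].
  by case: (mP i).
exists (fun i => coord b i x / (m i)%:R).
rewrite [LHS](coord_vbasis xF); apply: eq_bigr => i _.
have [mi _] := mP i.
have mi0 : (m i)%:R != 0 :> rat by rewrite pnatr_eq0 -lt0n.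
have -> : (m i)%:R * b`_i = (m i)%:R *: b`_i by rewrite scaler_nat mulr_natl.
by rewrite scalerA divfK.
Qed.

(* Dirichlet: the multiples [t x] with [t <= M] come within norm less than 1 of
   the lattice, by the box principle applied to their coordinates modulo 1. *)
Lemma dirichlet_approx (d : nat) (w : 'I_d -> L) :
  exists M : nat, forall q : 'I_d -> rat, exists t : nat, exists z : 'I_d -> int,
    [/\ (0 < t)%N, (t <= M)%N &
      `|normL (t%:R * (\sum_i q i *: w i) - \sum_i (z i)%:~R *: w i)| < 1].
Proof.
have [m mP] := normL_small w.
pose T := {ffun 'I_d -> 'I_m.+1}.
exists #|T| => q.
pose K : rat := m.+1%:R.
have K0 : 0 < K by rewrite ltr0n.
pose fl t i := Num.floor (K * (t%:R * q i)).
(* The residue tells which of [m.+1] equal parts of the unit interval holds the fractional part of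
   [t * q i]. *)
pose col t : T := [ffun i => inord (absz (fl t i %% m.+1%:Z)%Z)].
have [t1 [t2 [lt12 t2M eqc]]] := pigeonhole_nat col.
have modE i : (fl t1 i %% m.+1%:Z)%Z = (fl t2 i %% m.+1%:Z)%Z.
  have := congr1 (fun f : T => val (f i)) eqc; rewrite !ffunE /= !inordK; last first.
  - have := ltz_pmod (fl t1 i) (isT : 0 < m.+1%:Z).
    by have := modz_ge0 (fl t1 i) (isT : m.+1%:Z != 0); lia.
  - have := ltz_pmod (fl t2 i) (isT : 0 < m.+1%:Z).
    by have := modz_ge0 (fl t2 i) (isT : m.+1%:Z != 0); lia.
  have := modz_ge0 (fl t1 i) (isT : m.+1%:Z != 0).
  have := modz_ge0 (fl t2 i) (isT : m.+1%:Z != 0).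
  by lia.
(* These quotients are the integral parts of [t2 * q i] and [t1 * q i]. *)
pose z i := ((fl t2 i %/ m.+1%:Z)%Z - (fl t1 i %/ m.+1%:Z)%Z).
have flB i : (fl t2 i)%:~R - (fl t1 i)%:~R = K * (z i)%:~R.
  rewrite (divz_eq (fl t2 i) m.+1%:Z) (divz_eq (fl t1 i) m.+1%:Z) modE /z.
  rewrite intrB !intrD !intrM -[(m.+1%:Z)%:~R]/K.
  by ring.
exists (t2 - t1)%N, z; split; [by rewrite subn_gt0 | by rewrite (leq_trans _ t2M) // leq_subr |].
have -> : (t2 - t1)%N%:R * (\sum_i q i *: w i) - \sum_i (z i)%:~R *: w i
  = \sum_i ((t2 - t1)%N%:R * q i - (z i)%:~R) *: w i.
  rewrite mulr_sumr -sumrB; apply: eq_bigr => i _.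
  by rewrite scalerBl mulr_natl -scaler_nat scalerA.
apply: mP => i; rewrite -[_^-1]mul1r ltr_pdivlMr // -/K mulrC.
rewrite -{1}(gtr0_norm K0) -normrM mulrBr -flB natrB ?(ltnW lt12) //.
have h1 := floor_itv (K * (t1%:R * q i)).
have h2 := floor_itv (K * (t2%:R * q i)).
move: h1 h2; rewrite -/(fl t1 i) -/(fl t2 i) => /andP [a1 b1] /andP [a2 b2].
rewrite !intrD in b1 b2.
rewrite ltr_norml mulrBl mulrBr.
by apply/andP; split; lra.
Qed.

(** [t * x] differs from a lattice point by an algebraic integer of norm less than 1, that is by 0;
    since [t <= M], the multiplier [M!] works for all [x]. *)
Lemma lattice_index :
  exists d (w : 'I_d -> L) (D : nat), [/\ forall i, O (w i), (0 < D)%N &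
    forall x, O x -> exists z : 'I_d -> int, D%:R * x = \sum_i (z i)%:~R * w i].
Proof.
have [d [w [Ow wF]]] := integral_basis_approx.
have [M MP] := dirichlet_approx w.
exists d, w, M`!; split; [by [] | exact: fact_gt0 | move=> x Ox].
have [q xE] := wF x (proj1 Ox).
have [t [z [t0 tM]]] := MP q; rewrite -xE => lt1.
have zE : \sum_i (z i)%:~R *: w i = \sum_i (z i)%:~R * w i :> L.
  by apply: eq_bigr => i _; rewrite scaler_int mulrzl.
rewrite zE in lt1.
have : t%:R * x - \sum_i (z i)%:~R * w i = 0.
  apply: normL_lt1 lt1; apply: (proj2 (_ : O _)).
  apply: roiB; first by apply: roiM => //; exact: roi_nat.
  by apply: roi_sum => i _; apply: roiM => //; exact: roi_int.
move/eqP; rewrite subr_eq0 => /eqP tx.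
have /dvdnP [k kE] : (t %| M`!)%N by rewrite dvdn_fact // t0.
exists (fun i => k%:Z * z i); rewrite kE natrM -mulrA tx mulr_sumr.
by apply: eq_bigr => i _; rewrite intrM mulrA.
Qed.

(** The colour of [x] is the coordinate vector of [D * x] modulo [D * N]: for equal colours
    [D * (x - y)] is [D * N] times a lattice point, and [D] cancels. *)
Lemma residue_colouring (N : nat) : (0 < N)%N ->
  exists (T : finType) (c : L -> T), forall x y, O x -> O y -> c x = c y ->
    exists2 z, O z & x - y = N%:R * z.
Proof.
move=> N0; have [d [w [D [Ow D0 Dw]]]] := lattice_index.
have H x : exists z : 'I_d -> int, O x -> D%:R * x = \sum_i (z i)%:~R * w i.
  by have [/Dw [z zE]|nO] := pselect (O x); [exists z | exists (fun=> 0)].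
have [Z ZE] := boolp.choice H.
pose n := (D * N)%N; have n0 : (0 < n)%N by rewrite muln_gt0 D0.
have nz : n%:Z != 0 by rewrite -lt0n in n0 *; move: n0; lia.
exists {ffun 'I_d -> 'I_n.-1.+1}.
exists (fun x => [ffun i => inord (absz (Z x i %% n%:Z)%Z)]) => x y Ox Oy eqc.
have modE i : (Z x i %% n%:Z)%Z = (Z y i %% n%:Z)%Z.
  have := congr1 (fun f : {ffun 'I_d -> 'I_n.-1.+1} => val (f i)) eqc.
  have b a : (absz (a %% n%:Z)%Z < n.-1.+1)%N.
    by have := ltz_pmod a (n0 : 0 < n%:Z); have := modz_ge0 a nz; lia.
  rewrite !ffunE /= !inordK //.
  by have := modz_ge0 (Z x i) nz; have := modz_ge0 (Z y i) nz; lia.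
exists (\sum_i ((Z x i %/ n%:Z)%Z - (Z y i %/ n%:Z)%Z)%:~R * w i).
  by apply: roi_sum => i _; apply: roiM => //; exact: roi_int.
have D0' : D%:R != 0 :> L by rewrite natr_fieldExt_eq0 -lt0n.
apply: (mulfI D0'); rewrite mulrBr (ZE x Ox) (ZE y Oy) -sumrB !mulr_sumr.
apply: eq_bigr => i _; rewrite -mulrBl -intrB.
rewrite {1}(divz_eq (Z x i) n%:Z) {1}(divz_eq (Z y i) n%:Z) modE.
have -> (a b c e : int) : a * c + e - (b * c + e) = (a - b) * c by ring.
have nE : (n%:Z)%:~R = D%:R * N%:R :> L by rewrite -natrM.
by rewrite intrM nE; ring.
Qed.

(** An ideal containing [N] is a union of classes modulo [N], so its set of colours determines
    it. *)
Lemma ideal_colouring (N : nat) : (0 < N)%N ->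
  exists (T : finType) (c : (L -> Prop) -> {set T}), forall I J,
    is_ideal I -> is_ideal J -> I N%:R -> J N%:R ->
    (c I \subset c J -> forall x, I x -> J x) /\
    ((forall x, I x -> J x) -> c I \subset c J).
Proof.
move=> /residue_colouring [T [c cP]].
exists T, (fun I => [set t | `[< exists2 x, I x & c x = t >]]) => I J iI iJ IN JN.
split=> [/subsetP sub x Ix|sub]; last first.
  apply/subsetP => t; rewrite !inE => /asboolP [x Ix xt]; apply/asboolP.
  by exists x => //; exact: sub.
have : c x \in [set t | `[< exists2 x, I x & c x = t >]].
  by rewrite inE; apply/asboolP; exists x.
move/sub; rewrite inE => /asboolP [y Jy cyx].
have [z Oz xyE] := cP x y (ideal_sub iI Ix) (ideal_sub iJ Jy) (esym cyx).
have -> : x = z * N%:R + y by rewrite mulrC -xyE subrK.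
by apply: (idealD iJ) => //; apply: (idealM iJ).
Qed.

(** This plays the role of noetherianity: colour sets have bounded size, and a member of [C] with
    the most colours is maximal. *)
Lemma maximal_ideal_in (N : nat) (C : (L -> Prop) -> Prop) I0 : (0 < N)%N ->
  (forall I, C I -> is_ideal I /\ I N%:R) -> C I0 ->
  exists2 I, C I & forall J, C J -> (forall x, I x -> J x) ->
    forall x, J x -> I x.
Proof.
move=> /ideal_colouring [T [c cP]] Cid C0.
pose p k := `[< exists2 I, C I & #|c I| = k >].
have exP : exists k, p k by exists #|c I0|; apply/asboolP; exists I0.
have ub k : p k -> (k <= #|T|)%N.
  by move=> /asboolP [I _ <-]; exact: max_card.
case: (ex_maxnP exP ub) => k /asboolP [I CI cI] kmax.
exists I => // J CJ IJ; have [iI IN] := Cid I CI; have [iJ JN] := Cid J CJ.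
have [_ /(_ IJ) sub] := cP I J iI iJ IN JN.
have [+ _] := cP J I iJ iI JN IN; apply.
have -> : c I = c J; last by [].
apply/eqP; rewrite eqEcard sub cI; apply: kmax.
by apply/asboolP; exists J.
Qed.

(** Hurwitz's argument: [b] is a nonzero element of [I] of least absolute norm. Approximating
    [t * (a / b)] by a lattice point [s] gives [t * a - s * b] in [I] of smaller norm, hence 0, and
    [t] divides [M!], which is independent of [I]. *)
Lemma ideal_almost_principal :
  exists2 D : nat, (0 < D)%N & forall I, is_ideal I -> (exists2 x, I x & x != 0) ->
    exists b, [/\ I b, b != 0 & forall a, I a -> exists2 y, O y & D%:R * a = b * y].
Proof.
have [d [w [Ow wF]]] := integral_basis_approx.
have [M MP] := dirichlet_approx w.
exists M`!; first exact: fact_gt0.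
move=> I iI [x0 Ix0 x00].
pose p k := `[< exists b, [/\ I b, b != 0 & `|normL b| = k%:R] >].
have exP : exists k, p k.
  have [z zE] := normL_int (proj2 (ideal_sub iI Ix0)).
  exists (absz z); apply/asboolP; exists x0; split => //.
  by rewrite zE -intr_norm -abszE.
case: (ex_minnP exP) => k /asboolP [b [Ib b0 bk]] kmin.
exists b; split => // a Ia.
have abF : a / b \in F.
  by rewrite rpredM ?rpredV //; [case: (ideal_sub iI Ia) | case: (ideal_sub iI Ib)].
have [q qE] := wF _ abF.
have [t [z [t0 tM]]] := MP q; rewrite -qE.
set s := \sum_i _ => lt1.
have Os : O s.
  by apply: roi_sum => i _; rewrite scaler_int -mulrzl; apply: roiM => //; exact: roi_int.
pose r := t%:R * a - s * b.
have Ir : I r.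
  by apply: idealB => //; apply: (idealM iI) => //; exact: roi_nat.
have r0 : r = 0.
  apply/eqP; apply: contraT => rn0.
  have [zr zrE] := normL_int (proj2 (ideal_sub iI Ir)).
  have : (k <= absz zr)%N.
    apply: kmin; apply/asboolP; exists r; split => //.
    by rewrite zrE -intr_norm -abszE.
  rewrite leqNgt => /negP []; rewrite -(ltr_nat rat).
  have -> : (absz zr)%:R = `|normL r| by rewrite zrE -intr_norm -abszE.
  have -> : r = (t%:R * (a / b) - s) * b by rewrite mulrBl -mulrA divfK.
  rewrite normLM normrM -bk gtr_pMl //.
  by rewrite normr_gt0 normL_neq0.
have /dvdnP [e eE] : (t %| M`!)%N by rewrite dvdn_fact // t0.
exists (e%:R * s); first by apply: roiM => //; exact: roi_nat.
move/eqP: r0; rewrite subr_eq0 => /eqP taE.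
by rewrite eE natrM -mulrA taE; ring.
Qed.

End RingOfIntegers.

(** * Localization at a prime; the valuation ring property *)

Section Localization.
Variables (L : fieldExtType rat) (F : {subfield L}) (P : L -> Prop).
Local Notation O := (ring_of_integers F).
Hypothesis primeP : nonzero_prime_ideal O P.
Implicit Types (x y z s : L).

Lemma prime_is_ideal : is_ideal F P.
Proof. by case: primeP => [? [? [? [? _]]]]; split. Qed.
Local Notation iP := prime_is_ideal.

Lemma prime_not1 : ~ P 1.
Proof. by case: primeP => [_ [_ [_ [_ []]]]]. Qed.

Lemma primeM x y : O x -> O y -> P (x * y) -> P x \/ P y.
Proof. by case: primeP => [_ [_ [_ [_ [_ [H _]]]]]]; exact: H. Qed.

Lemma nonprimeM x y : O x -> O y -> ~ P x -> ~ P y -> ~ P (x * y).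
Proof. by move=> Ox Oy Px Py /primeM []. Qed.

Lemma nonprimeX x (n : nat) : O x -> ~ P x -> ~ P (x ^+ n).
Proof.
move=> Ox Px; elim: n => [|n IH]; first exact: prime_not1.
by rewrite exprS; apply: nonprimeM => //; exact: roiX.
Qed.

(** For [x] in [P], a denominator [m] of [x^-1] is in [P], as [m = (m * x^-1) * x]. Euclidean
    division by the least positive integer in [P] does the rest. *)
Lemma prime_natural : exists p : nat, [/\ (0 < p)%N, P p%:R &
  forall z : int, P z%:~R -> (p%:Z %| z)%Z].
Proof.
pose Q k := `[< (0 < k)%N /\ P k%:R >].
have exQ : exists k, Q k.
  have [x [Px x0]] : exists x, P x /\ x <> 0 by case: primeP => [_ [_ [_ [_ [_ [_ H]]]]]].
  have [xF _] := ideal_sub iP Px.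
  have [m m0 Om] := roi_denominator (rpredVr xF : x^-1 \in F).
  exists m; apply/asboolP; split => //.
  have -> : m%:R = (m%:R * x^-1) * x by rewrite divfK //; apply/eqP.
  exact: (idealM iP).
case: (ex_minnP exQ) => p /asboolP [p0 Pp] pmin.
exists p; split => // z Pz.
have pz : p%:Z != 0 by move: p0; lia.
apply/dvdz_mod0P.
have mge := modz_ge0 z pz; have mlt := ltz_pmod z (p0 : 0 < p%:Z).
have Pm : P (z %% p%:Z)%Z%:~R.
  have -> : (z %% p%:Z)%Z = z - (z %/ p%:Z)%Z * p%:Z by rewrite {2}(divz_eq z p%:Z); ring.
  rewrite intrB intrM; apply: (idealB iP) => //.
  by apply: (idealM iP) => //; exact: roi_int.
apply/eqP; apply: contraT => mn0.
have : (p <= absz (z %% p%:Z)%Z)%N.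
  apply: pmin; apply/asboolP; split; first by rewrite absz_gt0.
  by move: Pm; rewrite -{1}(gez0_abs mge).
by move: mge mlt; lia.
Qed.

(** Two powers of [s] agree modulo [p], so [s ^+ i * (1 - s ^+ (j - i))] is in [P], hence so is its
    second factor. *)
Lemma prime_maximal s : O s -> ~ P s -> exists t q, [/\ O t, P q & s * t + q = 1].
Proof.
move=> Os Ps; have [p [p0 Pp _]] := prime_natural.
have [T [c cP]] := residue_colouring F p0.
have [i [j [lt_ij _ eqc]]] := pigeonhole_nat (fun i => c (s ^+ i)).
have [z Oz E] := cP _ _ (roiX i Os) (roiX j Os) eqc.
have H : P (s ^+ i * (1 - s ^+ (j - i))).
  rewrite mulrBr mulr1 -exprD subnKC ?(ltnW lt_ij) // E mulrC.
  exact: (idealM iP).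
exists (s ^+ (j - i).-1), (1 - s ^+ (j - i)); split; first exact: roiX.
  have O1 : O (1 - s ^+ (j - i)) by apply: roiB; [exact: roi1 | exact: roiX].
  by have [/(nonprimeX Os Ps)|] := primeM (roiX i Os) O1 H.
by rewrite -exprS prednK ?subn_gt0 // addrC subrK.
Qed.

(** The local ring at [P] as a subset of [L]; [locm] is its maximal ideal. *)
Definition loc x := exists s, [/\ O s, ~ P s & O (s * x)].
Definition locm x := exists s, [/\ O s, ~ P s & P (s * x)].

Lemma loc_roi x : O x -> loc x.
Proof.
by move=> Ox; exists 1; split; [exact: roi1 | exact: prime_not1 | rewrite mul1r].
Qed.

Lemma loc_nat (n : nat) : loc n%:R.
Proof. by apply: loc_roi; exact: roi_nat. Qed.

Lemma loc1 : loc 1. Proof. exact: (loc_nat 1). Qed.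
Lemma loc0 : loc 0. Proof. exact: (loc_nat 0). Qed.

Lemma locM x y : loc x -> loc y -> loc (x * y).
Proof.
move=> [s [Os Ps Osx]] [t [Ot Pt Oty]]; exists (s * t).
by split; [exact: roiM | exact: nonprimeM | rewrite mulrACA; exact: roiM].
Qed.

Lemma locD x y : loc x -> loc y -> loc (x + y).
Proof.
move=> [s [Os Ps Osx]] [t [Ot Pt Oty]]; exists (s * t).
split; [exact: roiM | exact: nonprimeM |].
have -> : s * t * (x + y) = t * (s * x) + s * (t * y) by ring.
by apply: roiD; apply: roiM.
Qed.

Lemma locX x (n : nat) : loc x -> loc (x ^+ n).
Proof. by move=> lx; elim: n => [|n IH]; [exact: loc1 | rewrite exprS; exact: locM]. Qed.

Lemma loc_sum (T : Type) (r : seq T) (Q : pred T) (f : T -> L) :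
  (forall i, Q i -> loc (f i)) -> loc (\sum_(i <- r | Q i) f i).
Proof. by move=> lf; apply: big_ind => //; [exact: loc0 | exact: locD]. Qed.

Lemma loc_inv s : O s -> ~ P s -> loc s^-1.
Proof.
move=> Os Ps; exists s; split => //; rewrite divff; first exact: roi1.
by apply/eqP => s0; apply: Ps; rewrite s0; exact: (ideal0 iP).
Qed.

Lemma locm_loc x : locm x -> loc x.
Proof. by move=> [s [Os Ps Psx]]; exists s; split => //; exact: (ideal_sub iP). Qed.

Lemma locm_prime x : P x -> locm x.
Proof.
by move=> Px; exists 1; split; [exact: roi1 | exact: prime_not1 | rewrite mul1r].
Qed.

Lemma prime_locm x : O x -> locm x -> P x.
Proof. by move=> Ox [s [Os Ps /primeM []]]. Qed.

Lemma locmM x y : loc x -> locm y -> locm (x * y).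
Proof.
move=> [s [Os Ps Osx]] [t [Ot Pt Pty]]; exists (s * t).
by split; [exact: roiM | exact: nonprimeM | rewrite mulrACA; exact: (idealM iP)].
Qed.

Lemma locmD x y : locm x -> locm y -> locm (x + y).
Proof.
move=> [s [Os Ps Psx]] [t [Ot Pt Pty]]; exists (s * t).
split; [exact: roiM | exact: nonprimeM |].
have -> : s * t * (x + y) = t * (s * x) + s * (t * y) by ring.
by apply: (idealD iP); apply: (idealM iP).
Qed.

Lemma locmB x y : locm x -> locm y -> locm (x - y).
Proof.
move=> mx my; apply: locmD => //; rewrite -mulN1r; apply: locmM => //.
by apply: loc_roi; exact: (roi_int F (-1)).
Qed.

Lemma locm_sum (T : Type) (r : seq T) (Q : pred T) (f : T -> L) :
  (forall i, Q i -> locm (f i)) -> locm (\sum_(i <- r | Q i) f i).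
Proof.
move=> lf; apply: big_ind => //; last exact: locmD.
by apply: locm_prime; exact: (ideal0 iP).
Qed.

Lemma locm1 : ~ locm 1.
Proof. by move/(prime_locm (roi1 F)); exact: prime_not1. Qed.

Lemma loc_locmV x : x != 0 -> loc x -> ~ locm x^-1.
Proof. by move=> x0 lx /(locmM lx); rewrite divff //; exact: locm1. Qed.

(* The [u, 1/u] lemma: [y = c d * x] is integral, and it can be absorbed in the
   coefficient of degree [d - 1], which lowers the degree of the relation. *)
Lemma valuation_dichotomy_rel (d : nat) (c : nat -> L) x : x \in F ->
  (forall i, O (c i)) -> \sum_(i < d.+1) c i * x ^+ i = 0 ->
  (exists2 i, (i <= d)%N & ~ P (c i)) -> loc x \/ locm x^-1.
Proof.
move=> xF; elim: d c => [|d IH] c Oc rel [i lei Pci].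
  move: rel Pci; rewrite big_ord1 expr0 mulr1.
  by case: i lei => // _ -> []; exact: (ideal0 iP).
have Oy : O (c d.+1 * x).
  split; first by rewrite rpredM //; case: (Oc d.+1).
  by apply: (alg_int_lead _ rel) => j; case: (Oc j).
have [Pd|nPd] := pselect (P (c d.+1)); last by left; exists (c d.+1).
pose c' j := if j == d then c d.+1 * x + c d else c j.
have Oc' j : O (c' j) by rewrite /c'; case: eqP => // _; exact: roiD.
have rel' : \sum_(j < d.+1) c' j * x ^+ j = 0.
  rewrite -[RHS]rel [RHS]big_ord_recr [X in _ = X + _]big_ord_recr big_ord_recr /=.
  rewrite /c' eqxx -addrA; congr (_ + _); last by rewrite exprS; ring.
  by apply: eq_bigr => j _; rewrite ltn_eqF.
have [[j lej Pj]|allP] := pselect (exists2 j, (j <= d)%N & ~ P (c' j)).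
  by apply: (IH c') => //; exists j.
have {}allP j : (j <= d)%N -> P (c' j).
  by move=> lej; have [//|nP] := pselect (P (c' j)); case: allP; exists j.
(* Now the shorter relation has all its coefficients in [P]. Only the one of degree [d] was altered,
   so [c d] is the coefficient outside [P]; then [c d.+1 * x] is outside [P] and serves as
   denominator of [x^-1]. *)
have id : i = d.
  apply/eqP; apply: contraT => ne_id; case: Pci.
  have [->//|lt_i] := eqVneq i d.+1.
  have := allP i; rewrite /c' (negPf ne_id); apply.
  by rewrite -ltnS ltn_neqAle lt_i.
have nPy : ~ P (c d.+1 * x).
  move=> Py; apply: Pci; rewrite id.
  have := idealB iP (allP d (leqnn d)) Py.
  by rewrite /c' eqxx addrC addKr.
have x0 : x != 0.
  by apply/eqP => x0; apply: nPy; rewrite x0 mulr0; exact: (ideal0 iP).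
by right; exists (c d.+1 * x); split => //; rewrite mulfK.
Qed.

Lemma valuation_dichotomy x : x \in F -> loc x \/ locm x^-1.
Proof.
move=> xF; have [q [q1 rq]] := primitive_relation x.
have q0 : q != 0 by apply/eqP => q0; move: q1; rewrite q0 zcontents0.
apply: (@valuation_dichotomy_rel (size q).-1 (fun i => (q`_i)%:~R)) => //.
- by move=> i; exact: roi_int.
- move: rq; rewrite /root horner_coef => /eqP.
  have -> : size (map_poly (intr : int -> L) q) = size q.
    by apply: size_map_inj_poly => //; exact: intr_fieldExt_inj.
  rewrite prednK ?size_poly_gt0 // => rq; rewrite -[RHS]rq.
  by apply: eq_bigr => i _; rewrite coef_map.
- have [//|allP] := pselect (exists2 i, (i <= (size q).-1)%N & ~ P (q`_i)%:~R).
  have [p [p0 Pp pP]] := prime_natural.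
  have : (p%:Z %| zcontents q)%Z.
    rewrite dvdz_contents; apply/polyOverP => i; apply: pP.
    have [lti|gei] := ltnP i (size q); last first.
      by rewrite nth_default // mulr0z; exact: (ideal0 iP).
    have [//|nP] := pselect (P (q`_i)%:~R); case: allP; exists i => //.
    by rewrite -ltnS prednK // (leq_ltn_trans _ lti).
  rewrite q1 dvdz1 => /eqP p1; case: prime_not1.
  by move: Pp; rewrite (_ : p = 1%N).
Qed.

Lemma valuation_total x : x \in F -> loc x \/ loc x^-1.
Proof. by case/valuation_dichotomy => [|/locm_loc]; [left | right]. Qed.

Lemma valuation_dichotomyV x : x \in F -> loc x^-1 \/ locm x.
Proof.
by move=> xF; have := @valuation_dichotomy x^-1; rewrite invrK; apply; exact: rpredVr.
Qed.

End Localization.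

(** * Uniformizers and the valuation *)

Section Valuation.
Variables (L : fieldExtType rat) (F : {subfield L}) (P : L -> Prop).
Local Notation O := (ring_of_integers F).
Hypothesis primeP : nonzero_prime_ideal O P.
Local Notation iP := (prime_is_ideal primeP).
Local Notation loc := (loc F P).
Local Notation locm := (locm F P).
Implicit Types (x y z s : L).

Lemma roi_in x : O x -> x \in F. Proof. by case. Qed.

Lemma valuation_ideal k : k != 0 -> is_ideal F (fun y => O y /\ loc (y / k)).
Proof.
move=> k0; split=> [x []//||x y [Ox lx] [Oy ly]|a x Oa [Ox lx]].
- by split; [exact: roi0 | rewrite mul0r; exact: loc0].
- by split; [exact: roiD | rewrite mulrDl; exact: locD].
- by split; [exact: roiM | rewrite -mulrA; apply: locM => //; exact: loc_roi].
Qed.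

(** [pi] makes its ideal [I pi] maximal among those containing [p]. If [y] in [P] satisfies [pi / y]
    in [loc], then [I y] contains [I pi], and maximality puts [y] in [I pi]. *)
Lemma uniformizer_exists : exists pi, [/\ P pi, pi != 0 &
  forall x, locm x -> loc (x / pi)].
Proof.
have [p [p0 Pp _]] := prime_natural primeP.
have pn0 : p%:R != 0 :> L by rewrite natr_fieldExt_eq0 -lt0n.
pose I x := fun y => O y /\ loc (y / x).
pose C J := exists x, [/\ P x, x != 0, loc (p%:R / x) & J = I x].
have [|| J [pi [Ppi pi0 lpi JE]] Jmax] := @maximal_ideal_in _ F p C (I p%:R) p0.
- move=> J [x [Px x0 lx ->]]; split; first exact: valuation_ideal.
  by split => //; exact: roi_nat.
- by exists p%:R; split => //; rewrite divff //; exact: loc1.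
have piF := roi_in (ideal_sub iP Ppi).
exists pi; split => // x [s [Os Ps Psx]].
have s0 : s != 0 by apply/eqP => s0; apply: Ps; rewrite s0; exact: (ideal0 iP).
suff H y : P y -> loc (y / pi).
  have -> : x / pi = s^-1 * (s * x / pi) by rewrite -mulrA mulKf.
  by apply: locM => //; [exact: loc_inv | exact: H].
move=> Py; have [->|y0] := eqVneq y 0; first by rewrite mul0r; exact: loc0.
have Oy := ideal_sub iP Py; have yF := roi_in Oy.
have [//|] := valuation_total primeP (rpredM yF (rpredVr piF)).
rewrite invf_div => lpy.
have mul_pi z : loc (z / pi) -> loc (z / y).
  have -> : z / y = (z / pi) * (pi / y) by rewrite mulrA divfK.
  by move=> lz; exact: locM.
have CIy : C (I y) by exists y; split => //; exact: mul_pi.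
have sub z : J z -> I y z by rewrite JE => -[Oz lz]; split => //; exact: mul_pi.
have Iyy : I y y by split=> //; rewrite divff //; exact: loc1.
by have := Jmax _ CIy sub y Iyy; rewrite JE => -[].
Qed.

Variable pi : L.
Hypotheses (Ppi : P pi) (pi0 : pi != 0).
Hypothesis pi_gen : forall x, locm x -> loc (x / pi).

Let Opi : O pi. Proof. exact: (ideal_sub iP). Qed.
Let piX0 (k : nat) : pi ^+ k != 0. Proof. by rewrite expf_neq0. Qed.

Lemma ideal_powE (k : nat) x : ideal_pow O P k x <-> O x /\ loc (x / pi ^+ k).
Proof.
elim: k x => [|k IH] x /=.
  by rewrite expr0 divr1; split=> [Ox|[]//]; split => //; exact: loc_roi.
split=> [[r [rP ->]]|[Ox lx]].
  rewrite big_seq; split.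
    apply: roi_sum => ab /rP [Pa /IH [Ob _]].
    by apply: roiM => //; exact: (ideal_sub iP).
  rewrite mulr_suml; apply: loc_sum => // ab /rP [Pa /IH [Ob lb]].
  rewrite exprS invfM mulrACA; apply: locM => //.
  by apply: pi_gen; exact: locm_prime.
have [s [Os Ps Osx]] := lx.
have [t [q [Ot Pq stq]]] := prime_maximal primeP Os Ps.
set y := s * (x / pi ^+ k.+1) in Osx.
have sxE : s * x = pi ^+ k.+1 * y.
  by rewrite /y mulrCA [_ * (x / _)]mulrC divfK.
(* Split [x = q * x + (s * x) * t]: the first term gains its factor of [P] from [q], and the second
   is a multiple of [pi ^+ k.+1] in [O]. *)
exists [:: (q, x); (pi, pi ^+ k * (y * t))]; split; last first.
  rewrite big_cons big_seq1 /=.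
  have -> : pi * (pi ^+ k * (y * t)) = (s * x) * t by rewrite sxE exprS; ring.
  by rewrite -[LHS]mul1r -stq; ring.
move=> ab; rewrite !inE => /orP [] /eqP -> /=; split => //; apply/IH; split => //.
- have -> : x / pi ^+ k = pi * (x / pi ^+ k.+1).
    by rewrite exprS; field; rewrite pi0 piX0.
  by apply: locM => //; exact: loc_roi.
- by apply: roiM; [exact: roiX | exact: roiM].
- by rewrite mulrC mulKf //; apply: loc_roi => //; exact: roiM.
Qed.

(** Two powers of [pi] agree modulo a multiple [m] of [x], so [x] divides [pi ^+ i * u] with [u]
    outside [P]. If [pi ^+ i.+1] divided [x] locally, [pi] would be a local unit. *)
Lemma ord_bounded x : O x -> x != 0 -> exists k : nat, ~ loc (x / pi ^+ k).
Proof.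
move=> Ox x0; apply: contrapT => H.
have {}H k : loc (x / pi ^+ k) by apply: contrapT => nl; apply: H; exists k.
have [m m0 Om] := roi_denominator (rpredVr (roi_in Ox) : x^-1 \in F).
have [T [c cP]] := residue_colouring F m0.
have [i [j [lt_ij _ eqc]]] := pigeonhole_nat (fun i => c (pi ^+ i)).
have [z Oz E] := cP _ _ (roiX i Opi) (roiX j Opi) eqc.
pose u := 1 - pi ^+ (j - i).
have Ou : O u by apply: roiB; [exact: roi1 | exact: roiX].
have nPu : ~ P u.
  move=> Pu; apply: (prime_not1 primeP).
  rewrite -(subrK (pi ^+ (j - i)) 1); apply: (idealD iP) => //.
  rewrite -(prednK (_ : 0 < j - i)%N) ?subn_gt0 // exprSr.
  by apply: (idealM iP) => //; exact: roiX.
have u0 : u != 0 by apply/eqP => u0; apply: nPu; rewrite u0; exact: (ideal0 iP).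
apply: (@loc_locmV L F P primeP pi^-1); last by rewrite invrK; exact: locm_prime.
  by rewrite invr_eq0.
have -> : pi^-1 = (x / pi ^+ i.+1) * ((m%:R * x^-1) * z * u^-1).
  have -> : (x / pi ^+ i.+1) * ((m%:R * x^-1) * z * u^-1)
     = (m%:R * z) * (x * x^-1) * (pi ^+ i.+1)^-1 * u^-1 by ring.
  rewrite divff // mulr1 -E.
  have -> : pi ^+ i - pi ^+ j = pi ^+ i * u.
    by rewrite mulrBr mulr1 -exprD subnKC // ltnW.
  by rewrite exprS; field; rewrite ?u0 ?pi0 ?piX0.
apply: locM => //; apply: locM => //; last exact: loc_inv.
by apply: locM => //; exact: loc_roi.
Qed.

Lemma ord_integral x : O x -> x != 0 -> exists k : nat,
  loc (x / pi ^+ k) /\ ~ loc (x / pi ^+ k.+1).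
Proof.
move=> Ox x0; have [k0 nk0] := ord_bounded Ox x0.
have exQ : exists k, `[< ~ loc (x / pi ^+ k) >] by exists k0; apply/asboolP.
case: (ex_minnP exQ) => [[|k]] /asboolP nk kmin.
  by case: nk; rewrite expr0 divr1; exact: loc_roi.
exists k; split => //; apply: contrapT => nl.
have : (k.+1 <= k)%N by apply: kmin; apply/asboolP.
by rewrite ltnn.
Qed.

Lemma val_integral_loc a (v : nat) : O a -> a != 0 ->
  val_integral O P a v -> loc (a / pi ^+ v) /\ loc (pi ^+ v / a).
Proof.
move=> Oa a0 [/ideal_powE [_ la] nl]; split => //.
have {}nl : ~ loc (a / pi ^+ v.+1) by move=> la'; apply: nl; apply/ideal_powE.
have aF : a / pi ^+ v.+1 \in F.
  by apply: rpredM; [exact: roi_in | apply: rpredVr; exact/roi_in/roiX].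
have [//|] := valuation_dichotomy primeP aF.
rewrite invf_div => /pi_gen.
have -> : pi ^+ v.+1 / a / pi = pi ^+ v / a.
  by rewrite exprSr; field; rewrite pi0 a0.
by [].
Qed.

Lemma val_integral_exists a : O a -> a != 0 -> exists v, val_integral O P a v.
Proof.
move=> Oa a0; have [k [lk nk]] := ord_integral Oa a0.
by exists k; split; [apply/ideal_powE | move/ideal_powE => []].
Qed.

(** Every [v] related to [x] by [val_rel] makes [x] a local unit times [pi ^ v]; one exists, so the
    value picked by the choice operator has this property. *)
Lemma pval_spec x : x \in F -> x != 0 -> exists v : int,
  [/\ pval O P x = Some v, loc (x / pi ^ v) & loc (pi ^ v / x)].
Proof.
move=> xF x0; rewrite /pval (negPf x0).
have exv : exists v, val_rel O P x v.
  have [m m0 Om] := roi_denominator xF.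
  have mn0 : m%:R != 0 :> L by rewrite natr_fieldExt_eq0 -lt0n.
  have mx0 : m%:R * x != 0 by rewrite mulf_neq0.
  have [va vaP] := val_integral_exists Om mx0.
  have [vd vdP] := val_integral_exists (roi_nat F m) mn0.
  exists (va%:Z - vd%:Z), (m%:R * x), m%:R, va, vd.
  split=> //; split; first exact: roi_nat.
  do 2 (split; first exact/eqP).
  by split; first by rewrite mulrC mulKf.
have := ClassicalEpsilon.epsilon_spec (inhabits 0) _ exv.
set v := ClassicalEpsilon.epsilon _ _.
case=> [a [d [va [vd [Oa [Od [/eqP a0 [/eqP d0 [xE [vaP [vdP vE]]]]]]]]]]].
exists v; have [la la'] := val_integral_loc Oa a0 vaP.
have [ld ld'] := val_integral_loc Od d0 vdP.
have piv : pi ^ v = pi ^+ va / pi ^+ vd by rewrite vE expfzDr // -invr_expz.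
split => //; rewrite piv xE.
- have -> : a / d / (pi ^+ va / pi ^+ vd) = (a / pi ^+ va) * (pi ^+ vd / d).
    by rewrite invf_div; ring.
  exact: locM.
- have -> : pi ^+ va / pi ^+ vd / (a / d) = (pi ^+ va / a) * (d / pi ^+ vd).
    by rewrite invf_div; ring.
  exact: locM.
Qed.

Lemma locm_ord x (v : int) : x != 0 -> loc (x / pi ^ v) -> loc (pi ^ v / x) ->
  locm x <-> 0 < v.
Proof.
move=> x0 l1 l2; split=> [mx|v0].
  rewrite ltNge; apply/negP => v0.
  have nE : pi ^ v = (pi ^+ `|v|%N)^-1.
    have {1}-> : v = - (`|v|%N : int) by lia.
    by rewrite -invr_expz.
  move: mx; rewrite -[x]invrK; apply: loc_locmV => //; first by rewrite invr_eq0.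
  have -> : x^-1 = (pi ^ v / x) * pi ^+ `|v|%N.
    by rewrite nE mulrAC mulVf ?mul1r.
  by apply: locM => //; apply: loc_roi => //; exact: roiX.
have -> : x = (x / pi ^ v) * pi ^ v by rewrite divfK // expfz_neq0.
apply: locmM => //; apply: locm_prime => //.
case: v v0 {l1 l2} => // [[|n]] // _; rewrite -exprnP exprSr.
by apply: (idealM iP) => //; exact: roiX.
Qed.

End Valuation.

(** * Comparing valuations through the maximal ideal *)

Section ValuationOrder.
Variables (L : fieldExtType rat) (F : {subfield L}) (P : L -> Prop).
Local Notation O := (ring_of_integers F).
Hypothesis primeP : nonzero_prime_ideal O P.
Implicit Types (x y : L).

(** The condition [x != 0] reflects that nothing exceeds the value +infinity of 0; the case [y = 0]
    fits because 0 is in [locm]. *)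
Lemma vlt_pval x y : x \in F -> y \in F ->
  vlt (pval O P x) (pval O P y) <-> x != 0 /\ locm F P (y / x).
Proof.
move=> xF yF; have [pi [Ppi pi0 pi_gen]] := uniformizer_exists primeP.
have [->|x0] := eqVneq x 0; first by rewrite /pval eqxx; split=> // [[]].
have [vx [-> l1 l2]] := pval_spec primeP Ppi pi0 pi_gen xF x0.
have [->|y0] := eqVneq y 0.
  rewrite /pval eqxx mul0r; split=> // _; split => //.
  by apply: locm_prime => //; exact: (ideal0 (prime_is_ideal primeP)).
have [vy [-> l3 l4]] := pval_spec primeP Ppi pi0 pi_gen yF y0.
have yx0 : y / x != 0 by rewrite mulf_neq0 ?invr_eq0.
have vE : pi ^ (vy - vx) = pi ^ vy / pi ^ vx by rewrite expfzDr // -invr_expz.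
have H := @locm_ord _ _ _ primeP _ Ppi pi0 (y / x) (vy - vx) yx0.
rewrite /= -subr_gt0; split=> [lt|[_ lt]]; [split=> // |]; apply/H => //; rewrite vE.
1,3: have -> : y / x / (pi ^ vy / pi ^ vx) = (y / pi ^ vy) * (pi ^ vx / x)
    by rewrite invf_div; ring.
1,2: exact: locM.
all: have -> : pi ^ vy / pi ^ vx / (y / x) = (pi ^ vy / y) * (x / pi ^ vx)
    by rewrite invf_div; ring.
all: exact: locM.
Qed.

Lemma vlt_pval0 x : x \in F ->
  vlt (pval O P x) (Some 0) <-> x != 0 /\ locm F P x^-1.
Proof.
move=> xF; have [pi [Ppi pi0 pi_gen]] := uniformizer_exists primeP.
have [->|x0] := eqVneq x 0; first by rewrite /pval eqxx; split=> // [[]].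
have [v [-> l1 l2]] := pval_spec primeP Ppi pi0 pi_gen xF x0.
have xV0 : x^-1 != 0 by rewrite invr_eq0.
have lm := @locm_ord _ _ _ primeP _ Ppi pi0 x^-1 (- v) xV0.
have E1 : x^-1 / pi ^ (- v) = pi ^ v / x by rewrite -invr_expz invrK mulrC.
have E2 : pi ^ (- v) / x^-1 = x / pi ^ v by rewrite -invr_expz invrK mulrC.
rewrite E1 E2 in lm.
by rewrite /= -oppr_gt0; split=> [lt|[_ lt]]; [split=> // |]; apply/lm.
Qed.

End ValuationOrder.

(** * Gauss's lemma at a prime *)

Section Gauss.
Variables (L : fieldExtType rat) (F : {subfield L}) (P : L -> Prop).
Local Notation O := (ring_of_integers F).
Hypothesis primeP : nonzero_prime_ideal O P.
Local Notation iP := (prime_is_ideal primeP).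
Local Notation loc := (loc F P).
Local Notation locm := (locm F P).

(** [m] is the last index of least valuation. In the induction the new entry takes over unless its
    quotient by [f m] is in [locm]. *)
Lemma dominant_index (f : nat -> L) (n : nat) :
  (forall i, f i \in F) -> (exists2 i, (i < n)%N & f i != 0) ->
  exists m, [/\ (m < n)%N, f m != 0, forall i, (i < n)%N -> loc (f i / f m) &
    forall i, (m < i < n)%N -> locm (f i / f m)].
Proof.
move=> fF; elim: n => [[]//|n IH [i lei fi]].
have [ex|nex] := pselect (exists2 i, (i < n)%N & f i != 0); last first.
  have fz j : (j < n)%N -> f j = 0.
    by move=> ltj; apply/eqP/negPn/negP => nz; apply: nex; exists j.
  have ni : i = n.
    apply/eqP; rewrite eqn_leq -ltnS lei leqNgt; apply: contra fi => lti.
    by rewrite fz.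
  rewrite ni in fi; exists n; split => //.
    move=> j; rewrite ltnS leq_eqVlt => /orP [/eqP ->|/fz ->].
      by rewrite divff //; exact: loc1.
    by rewrite mul0r; exact: loc0.
  by move=> j; rewrite ltnS; case: ltngtP.
have [m [ltm fm l1 l2]] := IH ex.
have fnmF : f n / f m \in F by rewrite rpredM ?rpredV.
have [lm|[fn0 lV]] : locm (f n / f m) \/ f n != 0 /\ loc (f n / f m)^-1.
  have [->|fn0] := eqVneq (f n) 0.
    by left; rewrite mul0r; apply: locm_prime => //; exact: (ideal0 iP).
  by have [] := valuation_dichotomyV primeP fnmF; [right | left].
  exists m; split => //; first exact: ltnW.
    move=> j; rewrite ltnS leq_eqVlt => /orP [/eqP ->|/l1 //].
    exact: locm_loc.
  move=> j; rewrite ltnS => /andP [ltmj]; rewrite leq_eqVlt => /orP [/eqP -> //|ltj].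
  by apply: l2; rewrite ltmj.
exists n; split => // j; last by rewrite ltnS; case: ltngtP.
rewrite ltnS leq_eqVlt => /orP [/eqP ->|/l1 lj].
  by rewrite divff //; exact: loc1.
have -> : f j / f n = (f j / f m) * (f n / f m)^-1 by rewrite invf_div mulrA divfK.
exact: locM.
Qed.

Lemma dominant_coef (p : {poly L}) : p \is a polyOver F -> p != 0 ->
  exists m, [/\ p`_m != 0, forall i, loc (p`_i / p`_m) &
    forall i, (m < i)%N -> locm (p`_i / p`_m)].
Proof.
move=> /polyOverP pF p0.
have [|m [ltm pm l1 l2]] := @dominant_index (fun i => p`_i) (size p) pF.
  by exists (size p).-1; [rewrite prednK // size_poly_gt0 | rewrite -lead_coefE lead_coef_eq0].
exists m; split => // i => [|ltmi]; have [lti|gei] := ltnP i (size p).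
- exact: l1.
- by rewrite (nth_default 0 gei) mul0r; exact: loc0.
- by apply: l2; rewrite ltmi.
- rewrite (nth_default 0 gei) mul0r; apply: locm_prime => //; exact: (ideal0 iP).
Qed.

(* Gauss: the dominant indices of [f] and [q] add up to a dominant index of
   [f * q], which is [0] since [f * q] is a nonzero constant modulo [P]. *)
Lemma gauss_constant (f q r : {poly L}) s :
  f \is a polyOver F -> q \is a polyOver F -> f * q = s%:P + r ->
  O s -> ~ P s -> (forall i, P r`_i) ->
  f`_0 != 0 /\ forall i, (0 < i)%N -> locm (f`_i / f`_0).
Proof.
move=> fF qF fqE Os nPs Pr.
have cE : (f * q)`_0 = s + r`_0 by rewrite fqE coefD coefC.
have nPc : ~ P (s + r`_0).
  by move=> Pc; apply: nPs; rewrite -(addrK r`_0 s); apply: (idealB iP).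
have Oc : O (s + r`_0) by apply: roiD => //; exact: (ideal_sub iP).
have c0 : s + r`_0 != 0.
  by apply/eqP => c0; apply: nPc; rewrite c0; exact: (ideal0 iP).
have fq0 : f * q != 0 by apply/eqP => fq0; move: c0; rewrite -cE fq0 coef0 eqxx.
have /norP [f0 q0] : ~~ ((f == 0) || (q == 0)) by rewrite -mulf_eq0.
have [m [fm lf mf]] := dominant_coef fF f0.
have [n [qn lq mq]] := dominant_coef qF q0.
pose w := f`_m * q`_n.
have w0 : w != 0 by rewrite mulf_neq0.
(* In degree [m + n] any other product has its first index above [m] or its second above [n]. *)
have mn1 : locm ((f * q)`_(m + n) / w - 1).
  rewrite coefM (bigD1 (Ordinal (leq_addr n m : m < (m + n).+1)%N)) //= addKn.
  rewrite mulrDl divff // addrC addrA addNr add0r mulr_suml.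
  apply: locm_sum => // -[j ltj] /= nej.
  have -> : f`_j * q`_(m + n - j) / w = (f`_j / f`_m) * (q`_(m + n - j) / q`_n).
    by rewrite /w invfM mulrACA.
  have [ltjm|ltmj|ejm] := ltngtP j m.
  - by apply: locmM => //; apply: mq; lia.
  - by rewrite mulrC; apply: locmM => //; exact: mf.
  - by case/eqP: nej; apply: val_inj.
have mn0 : (m + n)%N = 0%N.
  apply/eqP; apply: contraT => mn0; case: (locm1 primeP).
  (* The constant term [s + r_0 = f_0 * q_0] is a local unit and a local multiple of [w]. In
     positive degree only [r] contributes to [f * q], which then contradicts [mn1]. *)
  have wV : loc w^-1.
    have -> : w^-1 = (f`_0 / f`_m) * (q`_0 / q`_n) * (s + r`_0)^-1.
      have -> : (f`_0 / f`_m) * (q`_0 / q`_n) = (s + r`_0) / w.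
        by rewrite -cE coefM big_ord1 subn0 /w invfM mulrACA.
      by rewrite mulrAC mulfV // mul1r.
    by apply: locM => //; [exact: locM | exact: loc_inv].
  have H : locm ((f * q)`_(m + n) / w).
    rewrite fqE coefD coefC (negPf mn0) add0r mulrC.
    by apply: locmM => //; exact: locm_prime.
  by have := locmB primeP H mn1; rewrite subKr.
have m0 : m = 0%N by lia.
by rewrite m0 in fm lf mf.
Qed.

End Gauss.

(** * Primes lying over [P] *)

Section LyingOver.
Variables (L : fieldExtType rat) (K E : {subfield L}) (P : L -> Prop).
Local Notation A := (ring_of_integers K).
Local Notation B := (ring_of_integers E).
Hypotheses (sKE : (K <= E)%VS) (primeP : nonzero_prime_ideal A P).
Local Notation iP := (prime_is_ideal primeP).

Lemma roi_sub x : A x -> B x.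
Proof. by move=> [xK ix]; split => //; exact: (subvP sKE). Qed.

(* An ideal maximal among those avoiding the multiplicative set [A \ P] is prime. *)
Lemma lying_over J (N : nat) : (0 < N)%N -> is_ideal E J -> J N%:R ->
  (forall x, A x -> J x -> P x) ->
  exists Q, [/\ nonzero_prime_ideal B Q, forall x, J x -> Q x &
    forall x, A x /\ Q x <-> P x].
Proof.
move=> N0 iJ JN JP.
pose C I := [/\ is_ideal E I, forall x, J x -> I x & forall x, A x -> I x -> P x].
have [|| Q [iQ JQ QP] Qmax] := @maximal_ideal_in _ E N C J N0.
- by move=> I [iI JI _]; split => //; exact: JI.
- by split.
have nQ1 : ~ Q 1 by move/(QP _ (roi1 K)); exact: prime_not1 primeP.
(* Otherwise [Q + B x] would still avoid [A \ P], against the maximality of [Q]. *)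
have escape x : B x -> ~ Q x -> exists s q b, [/\ A s, ~ P s, Q q, B b & s = q + b * x].
  move=> Bx nQx; apply: contrapT => H; apply: nQx.
  pose I z := exists q b, [/\ Q q, B b & z = q + b * x].
  have QI z : Q z -> I z.
    by move=> Qz; exists z, 0; split; rewrite ?mul0r ?addr0 //; exact: roi0.
  have iI : is_ideal E I.
    split=> [z [q [b [Qq Bb ->]]]||z1 z2 [q [b [Qq Bb ->]]] [q' [b' [Qq' Bb' ->]]]|].
    - by apply: roiD; [exact: (ideal_sub iQ) | exact: roiM].
    - exact/QI/(ideal0 iQ).
    - by exists (q + q'), (b + b'); split; [exact: (idealD iQ) | exact: roiD | ring].
    - move=> a z Ba [q [b [Qq Bb ->]]]; exists (a * q), (a * b).
      by split; [exact: (idealM iQ) | exact: roiM | ring].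
  have CI : C I.
    split=> // [z /JQ /QI //|z Az [q [b [Qq Bb zE]]]].
    by apply: contrapT => nPz; apply: H; exists z, q, b.
  apply: (Qmax I) => //; exists 0, 1.
  by split; [exact: (ideal0 iQ) | exact: roi1 | rewrite add0r mul1r].
have Qprime x y : B x -> B y -> Q (x * y) -> Q x \/ Q y.
  move=> Bx By Qxy; apply: contrapT => /not_orP [nQx nQy].
  have [s [q [b [As nPs Qq Bb sE]]]] := escape x Bx nQx.
  have [t [q' [b' [At nPt Qq' Bb' tE]]]] := escape y By nQy.
  apply: (nonprimeM primeP As At nPs nPt); apply: QP; first exact: roiM.
  have -> : s * t = t * q + ((b * x) * q' + (b * b') * (x * y)).
    by rewrite {1}sE mulrDl [q * t]mulrC {2}tE; ring.
  apply: (idealD iQ); first by apply: (idealM iQ) => //; exact: roi_sub.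
  apply: (idealD iQ); apply: (idealM iQ) => //; exact: roiM.
have N0' : N%:R <> 0 :> L by apply/eqP; rewrite natr_fieldExt_eq0 -lt0n.
have QN := JQ _ JN.
exists Q; split => //.
  split; first exact: (ideal_sub iQ).
  split; first exact: (ideal0 iQ).
  split; first exact: (idealD iQ).
  split; first exact: (idealM iQ).
  by split => //; split => //; exists N%:R.
move=> x; split=> [[Ax Qx]|Px]; first exact: QP.
have Ax := ideal_sub iP Px; split => //; apply: contrapT => nQx.
(* The contraction [P'] of [Q] is a nonzero prime inside [P]. As [P'] is maximal, an [x] in [P]
   outside it would put 1 in [P]. *)
pose P' z := A z /\ Q z.
have primeP' : nonzero_prime_ideal A P'.
  split; first by move=> z [].
  split; first by split; [exact: roi0 | exact: (ideal0 iQ)].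
  split; first by move=> y z [Ay Qy] [Az Qz]; split; [exact: roiD | exact: (idealD iQ)].
  split.
    move=> a z Aa [Az Qz]; split; first exact: roiM.
    by apply: (idealM iQ) => //; exact: roi_sub.
  split; first by case.
  split; last by exists N%:R; split => //; split => //; exact: roi_nat.
  move=> y z Ay Az [_ Qyz].
  by have [] := Qprime y z (roi_sub Ay) (roi_sub Az) Qyz; [left | right].
have [t [q [At [Aq Qq] xtE]]] := prime_maximal primeP' Ax (fun H : P' x => nQx (proj2 H)).
apply: (prime_not1 primeP); rewrite -xtE; apply: (idealD iP); last exact: QP.
by rewrite mulrC; apply: (idealM iP).
Qed.

End LyingOver.

(** * The implications (ii) -> (iii) and (iii) -> (i) *)

Section Implications.
Variables (L : fieldExtType rat) (K : {subfield L}) (g : L) (P : L -> Prop).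
Local Notation A := (ring_of_integers K).
Local Notation E := (<<K; g>>%AS : {subfield L}).
Local Notation B := (ring_of_integers E).
Hypothesis primeP : nonzero_prime_ideal A P.
Local Notation iP := (prime_is_ideal primeP).

Let sKE : (K <= E)%VS. Proof. exact: subv_adjoin. Qed.
Let gE : g \in E. Proof. exact: memv_adjoin. Qed.

Lemma inv_adjoin_pole_above (alpha : L) (Q : L -> Prop) :
  P alpha -> alpha != 0 -> adjoin_ring A g alpha^-1 ->
  nonzero_prime_ideal B Q -> (forall x, A x /\ Q x <-> P x) ->
  g != 0 /\ locm E Q g^-1.
Proof.
move=> Pa a0 [p [pA pE]] primeQ QP.
have nlg : ~ loc E Q g.
  move=> lg; apply: (@loc_locmV _ _ _ primeQ alpha^-1).
  - by rewrite invr_eq0.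
  - rewrite pE horner_coef; apply: loc_sum => // i _.
    apply: locM => //; last exact: locX.
    by apply: loc_roi => //; exact: (roi_sub sKE).
  - by rewrite invrK; apply: locm_prime => //; case/QP: Pa.
split; first by apply/eqP => g0; apply: nlg; rewrite [X in loc _ _ X]g0; exact: loc0.
by case: (valuation_dichotomy primeQ gE).
Qed.

(* Clearing denominators, the integral equation of [u], of degree [d], becomes an
   equation of [g] with constant term [s ^+ (n * d)] and all other coefficients
   divisible by [p]. *)
Lemma constant_mod_prime_of_integral (s u : L) (p n : nat) :
  (0 < n)%N -> P p%:R -> A s -> ~ P s -> g != 0 -> alg_int u ->
  (s / g) ^+ n = p%:R * u -> p%:R != 0 :> L ->
  (minPoly K g)`_0 != 0 /\ forall i, (0 < i)%N ->
    locm K P ((minPoly K g)`_i / (minPoly K g)`_0).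
Proof.
move=> n0 Pp As nPs g0 [q [mq rq]] hE p0.
pose d := (size q).-1.
have szq : size q = d.+1 by rewrite prednK // size_poly_gt0 monic_neq0.
have qd : q`_d = 1 by rewrite -lead_coefE (eqP mq).
(* After multiplication by [p ^+ d * g ^+ (n * d)], the [j]-th term of [q(u)] carries
   [p ^+ (d - j)]. One factor [p] is kept out of [c j], so that the coefficients of [r] are visibly
   in [P]. *)
pose c (j : nat) : L := (q`_j)%:~R * p%:R ^+ (d - j.+1) * s ^+ (n * j).
pose r : {poly L} := \sum_(j < d) (p%:R * c j) *: 'X^(n * (d - j)).
have Ac j : A (c j).
  apply: roiM; last exact: roiX.
  by apply: roiM; [exact: roi_int | apply: roiX; exact: roi_nat].
have Pr i : P r`_i.
  rewrite coef_sum. apply: (ideal_sum _ iP) => j _; rewrite coefZ coefXn mulrC mulrA.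
  rewrite mulrAC; apply: (idealM iP) => //; apply: roiM => //.
  exact: roi_nat.
pose G := (s ^+ (n * d))%:P + r.
have GK : G \is a polyOver K.
  apply: rpredD; first by rewrite polyOverC; case: (roiX (n * d) As).
  by apply/polyOverP => i; case: (ideal_sub iP (Pr i)).
have rG : root G g.
  have uE : u = (s / g) ^+ n / p%:R by rewrite hE mulrC mulKf.
  have q0 : \sum_(j < d.+1) (q`_j)%:~R * u ^+ j = 0.
    move: rq; rewrite /root horner_coef => /eqP rq; rewrite -[RHS]rq.
    have -> : size (map_poly (fun z : int => z%:~R : L) q) = d.+1.
      by rewrite -szq; apply: size_map_inj_poly => //; exact: intr_fieldExt_inj.
    by apply: eq_bigr => i _; rewrite coef_map.
  have pg0 : p%:R ^+ d * g ^+ (n * d) != 0 by rewrite mulf_neq0 ?expf_neq0.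
  have powE j : (j <= d)%N ->
    p%:R ^+ d * g ^+ (n * d) * u ^+ j = p%:R ^+ (d - j) * s ^+ (n * j) * g ^+ (n * (d - j)).
    move=> lejd; rewrite uE -{1 2}(subnK lejd) mulnDr !exprD exprMn exprVn -!exprM.
    rewrite exprMn exprVn [((n * j))%N]mulnC.
    by field; rewrite !expf_neq0.
  have : \sum_(j < d.+1) (q`_j)%:~R * (p%:R ^+ d * g ^+ (n * d) * u ^+ j) = 0.
    rewrite -[RHS](mulr0 (p%:R ^+ d * g ^+ (n * d))) -[in RHS]q0 mulr_sumr.
    by apply: eq_bigr => j _; ring.
  rewrite big_ord_recr /= powE // qd subnn muln0 !expr0 !mul1r mulr1 => q0'.
  rewrite /root /G /r hornerD hornerC horner_sum addrC -[X in _ == X]q0'.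
  apply/eqP; congr (_ + _); apply: eq_bigr => j _.
  rewrite hornerZ hornerXn powE ?(ltnW (ltn_ord j)) // /c.
  have -> : p%:R ^+ (d - j) = p%:R * p%:R ^+ (d - j.+1) :> L.
    by rewrite -exprS subnSK.
  by ring.
have /dvdpP [q' Gq'] := minPoly_dvdp GK rG.
have mp0 : minPoly K g != 0 by rewrite monic_neq0 // monic_minPoly.
have q'K : q' \is a polyOver K.
  have -> : q' = G %/ minPoly K g by rewrite Gq' mulpK.
  by rewrite divp_polyOver // minPolyOver.
apply: (gauss_constant primeP (minPolyOver K g) q'K _ (roiX (n * d) As) _ Pr).
  by rewrite mulrC -Gq'.
exact: (nonprimeX primeP As nPs).
Qed.

Lemma pole_above_minPoly :
  (forall Q, nonzero_prime_ideal B Q -> (forall x, A x /\ Q x <-> P x) ->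
    g != 0 /\ locm E Q g^-1) ->
  (minPoly K g)`_0 != 0 /\ forall i, (0 < i)%N ->
    locm K P ((minPoly K g)`_i / (minPoly K g)`_0).
Proof.
move=> pole; have [p [p0 Pp _]] := prime_natural primeP.
have pn0 : p%:R != 0 :> L by rewrite natr_fieldExt_eq0 -lt0n.
have Bp : B p%:R by exact: roi_nat.
(* Some prime lies above [P], by [lying_over] applied to [p B], and [g] has a pole there. *)
have g0 : g != 0.
  pose J b := exists2 y, B y & b = p%:R * y.
  have iJ : is_ideal E J.
    split=> [x [y By ->]||x1 x2 [y1 B1 ->] [y2 B2 ->]|a x Ba [y By ->]].
    - exact: roiM.
    - by exists 0; [exact: roi0 | rewrite mulr0].
    - by exists (y1 + y2); [exact: roiD | rewrite mulrDr].
    - by exists (a * y); [exact: roiM | ring].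
  have Jp : J p%:R by exists 1; [exact: roi1 | rewrite mulr1].
  have JP x : A x -> J x -> P x.
    move=> Ax [y [_ iy] xE]; rewrite xE mulrC; apply: (idealM iP) => //; split => //.
    by rewrite -(mulKf pn0 y) -xE rpredM ?rpredV ?rpred_nat //; case: Ax.
  by have [Q [primeQ _ /(pole _ primeQ) []]] := lying_over sKE primeP p0 iJ Jp JP.
pose J b := B b /\ exists2 y : {poly L}, (forall i, B y`_i) & b = p%:R * g * y.[g].
have iJ : is_ideal E J.
  split=> [x []//||x1 x2 [Bx1 [y1 B1 E1]] [Bx2 [y2 B2 E2]]|a x Ba [Bx [y By xE]]].
  - split; first exact: roi0.
    by exists 0; [move=> i; rewrite coef0; exact: roi0 | rewrite horner0 mulr0].
  - split; first exact: roiD.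
    by exists (y1 + y2); [move=> i; rewrite coefD; exact: roiD | rewrite hornerD mulrDr E1 E2].
  - split; first exact: roiM.
    exists (a *: y); first by move=> i; rewrite coefZ; exact: roiM.
    by rewrite hornerZ xE; ring.
(* The constant polynomial [m / g] shows that [J] contains the positive integer [p * m], as
   [lying_over] demands. *)
have [m m0 Bmg] := roi_denominator (rpredVr gE : g^-1 \in E).
have JN : J (p * m)%:R.
  split; first exact: roi_nat.
  exists (m%:R * g^-1)%:P.
    by move=> i; rewrite coefC; case: ifP => // _; exact: roi0.
  by rewrite hornerC natrM; field.
have [JP|] := pselect (forall x, A x -> J x -> P x).
  have N0 : (0 < p * m)%N by rewrite muln_gt0 p0.
  have [Q [primeQ JQ QP]] := lying_over sKE primeP N0 iJ JN JP.
  have [_ lg] := pole Q primeQ QP.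
  have [pi [Qpi pi0 pi_gen]] := uniformizer_exists primeQ.
  have [k kP] := val_integral_exists primeQ Qpi pi0 pi_gen Bp pn0.
  have [_ lk] := val_integral_loc primeQ Qpi pi0 pi_gen Bp pn0 kP.
  (* With [k] the order of [p] at [Q], this product equals [1 / (p * g ^+ k.+1)]. Its denominator
     [s] outside [Q] is then [p * g * (y * g ^+ k)] with [y] in [B], so it is in [J], hence in
     [Q]. *)
  have [s [Bs nQs Bsy]] : loc E Q ((pi ^+ k / p%:R) * (g^-1 / pi) ^+ k * g^-1).
    apply: locM => //; last exact: locm_loc.
    by apply: locM => //; apply: locX => //; exact: pi_gen.
  case: nQs; apply: JQ; split => //.
  set y := s * _ in Bsy; exists (y *: 'X^k).
    by move=> i; rewrite coefZ coefXn; apply: roiM => //; exact: roi_nat.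
  rewrite hornerZ hornerXn /y !exprMn !exprVn.
  by field; rewrite !expf_neq0 // pn0 g0.
move=> H; have [s [As [_ [y By sE]] nPs]] : exists s, [/\ A s, J s & ~ P s].
  apply: contrapT => H'; apply: H => x Ax Jx; apply: contrapT => nPx.
  by apply: H'; exists x.
pose n := size y.
have n0 : (0 < n)%N.
  rewrite lt0n; apply/eqP => /eqP; rewrite size_poly_eq0 => /eqP y0.
  by apply: nPs; rewrite sE y0 horner0 mulr0; exact: (ideal0 iP).
have s0 : s != 0 by apply/eqP => s0; apply: nPs; rewrite s0; exact: (ideal0 iP).
pose h := s / g.
(* Multiplying [s = p * g * y.[g]] by [s ^+ n.-1 / g ^+ n] turns its term of degree [i] into one in
   [s ^+ i * h ^+ (n - i.+1)]; [u] lists these in reverse order. The resulting [h ^+ n = p * u] is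
   also an integral equation for [h]. *)
pose u := \sum_(i < n) y`_(n - i.+1) * s ^+ (n - i.+1) * h ^+ i.
have hu : h ^+ n = p%:R * u.
  have E1 i : (i < n)%N -> s ^+ i * h ^+ (n - i.+1) = s ^+ n.-1 / g ^+ n * g ^+ i.+1.
    move=> lti; rewrite /h exprMn exprVn mulrA -exprD.
    have -> : (i + (n - i.+1) = n.-1)%N by lia.
    rewrite -mulrA; congr (_ * _).
    have -> : g ^+ n = g ^+ (n - i.+1) * g ^+ i.+1 by rewrite -exprD subnK.
    by field; rewrite !expf_neq0.
  have -> : u = \sum_(i < n) s ^+ n.-1 / g ^+ n * (g * (y`_i * g ^+ i)).
    rewrite /u (reindex_inj rev_ord_inj) /=; apply: eq_bigr => i _.
    have -> : (n - (n - i.+1).+1 = i)%N by have := ltn_ord i; lia.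
    by rewrite -mulrA E1 // exprS; ring.
  rewrite -!mulr_sumr -horner_coef.
  have -> : p%:R * (s ^+ n.-1 / g ^+ n * (g * y.[g])) = s ^+ n.-1 / g ^+ n * s.
    by rewrite [X in _ = _ * X]sE; ring.
  by rewrite /h exprMn exprVn mulrAC -exprSr prednK.
have ih : alg_int h.
  apply: (@alg_int_dep _ n (fun i => p%:R * (y`_(n - i.+1) * s ^+ (n - i.+1)))).
    move=> i; apply: alg_intM; first exact: alg_int_nat.
    by apply: alg_intM; [case: (By (n - i.+1)%N) | case: (roiX (n - i.+1) As)].
  by rewrite hu mulr_sumr; apply: eq_bigr => i _; rewrite mulrA.
have Bh : B h.
  split => //; rewrite rpredM ?rpredV //.
  by case: (roi_sub sKE As).
have Bu : B u.
  apply: roi_sum => i _; apply: roiM; last exact: roiX.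
  by apply: roiM => //; apply: roiX; exact: (roi_sub sKE).
by apply: (constant_mod_prime_of_integral n0 Pp As nPs g0 (proj2 Bu) hu).
Qed.

End Implications.

(** * Torsion of the class of [P]; the implication (i) -> (ii) *)

Section TorsionClass.
Variables (L : fieldExtType rat) (K : {subfield L}) (g : L) (P : L -> Prop).
Local Notation A := (ring_of_integers K).
Hypothesis primeP : nonzero_prime_ideal A P.
Local Notation iP := (prime_is_ideal primeP).
Local Notation loc := (loc K P).
Local Notation locm := (locm K P).

(* [x ^+ m] has bounded denominator, so two powers of [x] differ by an element
   of [A], which is a monic equation for [x]. *)
Lemma almost_integral x a : x \in K -> A a -> a != 0 ->
  (forall m : nat, A (x ^+ m * a)) -> A x.
Proof.
move=> xK Aa a0 H; split => //.
have [N N0 [aVK iN]] := roi_denominator (rpredVr (proj1 Aa) : a^-1 \in K).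
have N0' : N%:R != 0 :> L by rewrite natr_fieldExt_eq0 -lt0n.
have AN m : A (N%:R * x ^+ m).
  have -> : N%:R * x ^+ m = (x ^+ m * a) * (N%:R * a^-1) by field.
  exact: roiM.
have [T [c cP]] := residue_colouring K N0.
have [i [j [lt_ij _ eqc]]] := pigeonhole_nat (fun m => c (N%:R * x ^+ m)).
have [z Az E] := cP _ _ (AN i) (AN j) eqc.
have zE : x ^+ j = x ^+ i - z by apply: (mulfI N0'); rewrite mulrBr -E opprB addrC subrK.
apply: (@alg_int_root_monic _ ('X^j - ('X^i - z%:P))).
- rewrite monicE lead_coefDl ?lead_coefXn // size_polyN size_polyXn ltnS.
  apply: (leq_trans (size_polyD _ _)); rewrite geq_max size_polyXn lt_ij size_polyN.
  by apply: (leq_trans (size_polyC_leq1 _)); apply: leq_trans lt_ij.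
- move=> k; apply: (proj2 (_ : A _)); rewrite !coefB !coefXn coefC.
  apply: roiB; first exact: roi_nat.
  apply: roiB; first exact: roi_nat.
  by case: ifP => // _; exact: roi0.
- by rewrite /root !(hornerD, hornerN, hornerXn, hornerC) zE subrr.
Qed.

Lemma locm_common_denominator (x : nat -> L) (n : nat) :
  (forall i, (i < n)%N -> locm (x i)) ->
  exists s, [/\ A s, ~ P s & forall i, (i < n)%N -> P (s * x i)].
Proof.
elim: n => [|n IH] H.
  by exists 1; split => //; [exact: roi1 | exact: prime_not1 primeP].
have [s [As nPs sP]] := IH (fun i lti => H i (ltnW lti)).
have [t [At nPt tP]] := H n (ltnSn n).
exists (s * t); split; [exact: roiM | exact: (nonprimeM primeP) |] => i.
rewrite ltnS leq_eqVlt => /orP [/eqP ->|/sP Psx].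
  by rewrite -mulrA; apply: (idealM iP).
by rewrite mulrAC mulrC; apply: (idealM iP).
Qed.

(** Dividing by [f_0] gives [1 = - g * \sum_i x i * g ^+ i] with [x i] in [locm]. For a common
    denominator [s] with [s * t + q = 1], substituting this for the last factor of [q + t * s * 1]
    leaves only coefficients in [P]. *)
Lemma prime_comb_eq1 (f : {poly L}) : root f g -> f`_0 != 0 ->
  (forall i, (0 < i < size f)%N -> locm (f`_i / f`_0)) ->
  exists2 c : {poly L}, (forall i, P c`_i) & c.[g] = 1.
Proof.
move=> rf f0 H.
have sz0 : (0 < size f)%N.
  by rewrite lt0n size_poly_eq0; apply: contra f0 => /eqP ->; rewrite coef0.
pose x i := f`_i.+1 / f`_0.
have [|s [As nPs sP]] := @locm_common_denominator x (size f).-1.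
  by move=> i lti; apply: H; rewrite /= -(prednK sz0) ltnS.
have [t [q [At Pq stq]]] := prime_maximal primeP As nPs.
exists (q%:P - 'X * \poly_(i < (size f).-1) (t * (s * x i))).
  move=> i; rewrite coefB coefC coefXM coef_poly; apply: (idealB iP).
    by case: ifP => // _; exact: (ideal0 iP).
  case: ifP => // _; first exact: (ideal0 iP).
  case: ifP => [lti|_]; last exact: (ideal0 iP).
  by apply: (idealM iP) => //; exact: sP.
have sE : g * \sum_(i < (size f).-1) x i * g ^+ i = -1.
  move: rf; rewrite /root horner_coef -(prednK sz0) big_ord_recl expr0 mulr1 /=.
  rewrite addrC addr_eq0 => /eqP E.
  apply: (mulfI f0); rewrite mulrN1 -E !mulr_sumr; apply: eq_bigr => i _.
  by rewrite /x /bump /= add1n exprS; field.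
rewrite hornerD hornerN hornerC hornerM hornerX horner_poly.
have -> : \sum_(i < (size f).-1) t * (s * x i) * g ^+ i
    = (t * s) * \sum_(i < (size f).-1) x i * g ^+ i.
  by rewrite mulr_sumr; apply: eq_bigr => i _; ring.
by rewrite mulrCA sE mulrN1 opprK -stq; ring.
Qed.

(* The class of [P] is torsion: by [ideal_almost_principal] the ideals
   [(D / b k) I_k], with [I_k] the [k]-th symbolic power of [P], all contain [D],
   so two of them coincide and [b j / b i] generates [I_j / I_i]. *)
Lemma inv_adjoin_of_prime_comb (c : {poly L}) :
  (forall i, P c`_i) -> c.[g] = 1 ->
  exists alpha, [/\ P alpha, alpha != 0 & adjoin_ring A g alpha^-1].
Proof.
move=> Pc c1.
have [pi [Ppi pi0 pi_gen]] := uniformizer_exists primeP.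
have Api := ideal_sub iP Ppi.
have piX0 k : pi ^+ k != 0 by rewrite expf_neq0.
pose I (k : nat) := fun x => A x /\ loc (x / pi ^+ k).
have iI k : is_ideal K (I k) by exact: valuation_ideal.
have Ipi k : I k (pi ^+ k) by split; [exact: roiX | rewrite divff ?piX0 //; exact: (loc1 primeP)].
have cI k : (forall i, I k (c ^+ k)`_i).
  elim: k => [|k IH] i.
    rewrite expr0 coef1; split; first exact: roi_nat.
    by rewrite expr0 divr1; exact: (loc_nat primeP).
  rewrite exprS coefM; apply: (ideal_sum _ (iI k.+1)) => j _; split.
    by apply: roiM; [exact: (ideal_sub iP) | case: (IH (i - j)%N)].
  rewrite exprS invfM mulrACA; apply: locM => //; last by case: (IH (i - j)%N).
  by apply: pi_gen; exact: locm_prime.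
have [D D0 bex] := ideal_almost_principal K.
have D0' : D%:R != 0 :> L by rewrite natr_fieldExt_eq0 -lt0n.
have H k : exists b, [/\ I k b, b != 0 &
    forall a, I k a -> exists2 y, A y & D%:R * a = b * y].
  by apply: (bex _ (iI k)); exists (pi ^+ k); [exact: Ipi | exact: piX0].
have [b bP] := boolp.choice H.
have bA k : A (b k) by case: (bP k) => [[]].
have b0 k : b k != 0 by case: (bP k).
(* By the choice of [b k] this multiple of [I k] lies in [A]; as it contains [D], only finitely many
   such ideals occur. *)
pose J k x := exists2 a, I k a & x = D%:R * a / b k.
have iJ k : is_ideal K (J k).
  split=> [x [a Ia ->]||x1 x2 [a1 I1 ->] [a2 I2 ->]|e x Ae [a Ia ->]].
  - have [_ _ /(_ a Ia) [y Ay ->]] := bP k.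
    by rewrite mulrC mulKf.
  - by exists 0; [exact: (ideal0 (iI k)) | rewrite mulr0 mul0r].
  - by exists (a1 + a2); [exact: (idealD (iI k)) | ring].
  - by exists (e * a); [exact: (idealM (iI k)) | ring].
have JD k : J k D%:R by exists (b k); [case: (bP k) | rewrite mulfK].
have [T [col colP]] := ideal_colouring K D0.
have [i [j [lt_ij _ eqc]]] := pigeonhole_nat (fun k => col (J k)).
have Jij x : J i x -> J j x.
  by have [+ _] := colP _ _ (iJ i) (iJ j) (JD i) (JD j); rewrite eqc; apply.
have Jji x : J j x -> J i x.
  by have [+ _] := colP _ _ (iJ j) (iJ i) (JD j) (JD i); rewrite eqc; apply.
pose gam := b j / b i.
have gam0 : gam != 0 by rewrite mulf_neq0 ?invr_eq0.
have gamI a : I i a -> I j (gam * a).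
  move=> Ia; have [|a' Ia' aE] := Jij (D%:R * a / b i); first by exists a.
  suff -> : gam * a = a' by [].
  apply: (mulfI D0'); rewrite /gam.
  have -> : D%:R * (b j / b i * a) = b j * (D%:R * a / b i) by ring.
  by rewrite aE; field; rewrite !b0.
have gamVI a : I j a -> I i (gam^-1 * a).
  move=> Ia; have [|a' Ia' aE] := Jji (D%:R * a / b j); first by exists a.
  suff -> : gam^-1 * a = a' by [].
  apply: (mulfI D0'); rewrite /gam invf_div.
  have -> : D%:R * (b i / b j * a) = b i * (D%:R * a / b j) by ring.
  by rewrite aE; field; rewrite !b0.
have piE : pi ^+ j = pi ^+ (j - i) * pi ^+ i by rewrite -exprD subnK // ltnW.
have Iji x : I j x -> I i x.
  move=> [Ax lx]; split => //.
  have -> : x / pi ^+ i = (x / pi ^+ j) * pi ^+ (j - i).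
    by rewrite piE; field; rewrite !piX0.
  by apply: locM => //; apply: loc_roi => //; exact: roiX.
have gamK : gam \in K by rewrite rpredM ?rpredV //; [case: (bA j) | case: (bA i)].
(* Multiplication by [gam] maps [I i] into [I j], inside [I i]; so [gam ^+ m * pi ^+ i] stays in [A]
   for every [m]. *)
have Agam : A gam.
  apply: (almost_integral gamK (roiX i Api) (piX0 i)) => m.
  suff : I i (gam ^+ m * pi ^+ i) by case.
  elim: m => [|m IH]; first by rewrite expr0 mul1r.
  by rewrite exprS -mulrA; apply: Iji; exact: gamI.
(* [gam * pi ^+ i] is in [I j] and [i < j], so [gam] is a local multiple of [pi ^+ (j - i)]. *)
exists gam; split => //.
  apply: (prime_locm primeP Agam).
  have -> : gam = (gam * pi ^+ i / pi ^+ j) * pi ^+ (j - i).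
    by rewrite piE; field; rewrite !piX0.
  apply: locmM => //; first by case: (gamI _ (Ipi i)).
  rewrite -(prednK (_ : 0 < j - i)%N) ?subn_gt0 // exprSr.
  apply: locmM => //; last exact: locm_prime.
  by apply: loc_roi => //; exact: roiX.
(* [c ^+ j] takes the value 1 at [g] and has coefficients in [I j], which [gam^-1] sends into [I i],
   within [A]. *)
exists (gam^-1 *: c ^+ j); split; last by rewrite hornerZ horner_exp c1 expr1n mulr1.
by move=> k; rewrite coefZ; case: (gamVI _ (cI j k)).
Qed.

End TorsionClass.

(** * The cycle of implications *)

Theorem mainTheorem2 (L : fieldExtType rat) (K : {subfield L}) (g : L)
    (P : L -> Prop) :
  nonzero_prime_ideal (ring_of_integers K) P ->
  [<-> (* (i) *)
       forall i : nat, (0 < i < size (minPoly K g))%N ->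
         vlt (pval (ring_of_integers K) P (minPoly K g)`_0)
             (pval (ring_of_integers K) P (minPoly K g)`_i);
       (* (ii) *)
       exists alpha : L, P alpha /\ alpha != 0 /\
         adjoin_ring (ring_of_integers K) g alpha^-1;
       (* (iii) *)
       forall Q : L -> Prop,
         nonzero_prime_ideal (ring_of_integers <<K; g>>%VS) Q ->
         (forall x, ring_of_integers K x /\ Q x <-> P x) ->
         vlt (pval (ring_of_integers <<K; g>>%VS) Q g) (Some 0)].
Proof.
move=> primeP.
have fK i : (minPoly K g)`_i \in K by apply/polyOverP/minPolyOver.
have gE : g \in <<K; g>>%VS by exact: memv_adjoin.
tfae.
- move=> val_gt.
  (* The degree is positive, so (i) applies at index 1 and forces a nonzero constant term. *)
  have sz2 : (1 < size (minPoly K g))%N by rewrite size_minPoly ltnS.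
  have /(vlt_pval primeP (fK 0%N) (fK 1%N)) [f0 _] := val_gt 1%N sz2.
  have [|c Pc c1] := @prime_comb_eq1 L K g P primeP (minPoly K g) (root_minPoly K g) f0.
    by move=> i /val_gt /(vlt_pval primeP (fK 0%N) (fK i)) [].
  have [alpha [Pa a0 adj]] := inv_adjoin_of_prime_comb primeP Pc c1.
  by exists alpha.
- move=> [alpha [Pa [a0 adj]]] Q primeQ QP.
  apply/(@vlt_pval0 L <<K; g>>%AS Q primeQ g gE).
  exact: (inv_adjoin_pole_above Pa a0 adj primeQ QP).
- move=> pole i /andP [i0 _].
  have [|f0 fi] := @pole_above_minPoly L K g P primeP.
    by move=> Q primeQ QP; apply/(@vlt_pval0 L <<K; g>>%AS Q primeQ g gE); exact: pole.
  by apply/(vlt_pval primeP (fK 0%N) (fK i)); split => //; exact: fi.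
Qed.
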